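(* Let $a,m\ge0$, $n,\ell\ge1$ and $0\le p\le\ell$ be integers. Let $\mathcal{E}^p_\ell(n,a,m)$ be the arrangement in $\mathbb{R}^\ell$ consisting of the hyperplanes $x_i-x_j=s$ for $1\le i<j\le\ell$ and integers $-a\le s\le a$; $x_i=s$ for $1\le i\le p$ and integers $-na\le s\le m$; and $x_i=s$ for $p<i\le\ell$ and integers $-na\le s\le m+1$. Then the cone $\mathbf{c}\mathcal{E}^p_\ell(n,a,m)$ is ind-flag-accurate with exponents $$\big(1,\ c+\ell-p+1,\ c+2,\ c+3,\dots,\ c+\ell\big),\qquad c=m+a(\ell+n-1).$$ As a consequence, for integers $c'\ge1$, $m\ge0$, the arrangement $\mathcal{E}^p_\ell(c',1,m)$ (hyperplanes $x_i-x_j\in\{-1,0,1\}$ for $i<j$, $x_i=s$ with $-c'\le s\le m$ for $i\le p$, $x_i=s$ with $-c'\le s\le m+1$ for $i>p$) has ind-flag-accurate cone with exponents $(1,\ c''+\ell-p+1,\ c''+2,\dots,c''+\ell)$ where $c''=m+\ell+c'-1$.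
   Context: For an affine arrangement $\mathcal{A}$ in $\mathbb{R}^\ell$, its cone $\mathbf{c}\mathcal{A}$ is the central arrangement in $V'=\mathbb{R}^{\ell+1}$ (extra coordinate $z$) consisting of the hyperplanes $a_1x_1+\dots+a_\ell x_\ell=dz$ for each hyperplane $a_1x_1+\dots+a_\ell x_\ell=d$ of $\mathcal{A}$, together with $z=0$. For a central arrangement $\mathcal{A}$ in $W=\mathbb{R}^N$: $L(\mathcal{A})$ is the set of intersections of subsets of $\mathcal{A}$ (including $W$); $\mathcal{A}^X=\{H\cap X:H\in\mathcal{A},X\not\subseteq H\}$; $\mathcal{A}$ is free if $D(\mathcal{A})=\{\theta\in\mathrm{Der}(S):\theta(\alpha_H)\in\alpha_HS\ \forall H\}$ is free over $S=\mathbb{R}[x_1,\dots,x_N]$, exponents being degrees of a homogeneous basis. Inductively free arrangements: smallest class containing empty arrangements and containing $\mathcal{A}$ whenever some $H\in\mathcal{A}$ has $\mathcal{A}\setminus\{H\}$ and $\mathcal{A}^H$ in the class with $\exp(\mathcal{A}^H)\subseteq\exp(\mathcal{A}\setminus\{H\})$. $\mathcal{A}$, free with exponents $e_1\le\dots\le e_N$, is ind-flag-accurate if it is inductively free and there is a flag $X_1\subseteq\dots\subseteq X_N=W$ in $L(\mathcal{A})$ with $\dim X_d=d$ and each $\mathcal{A}^{X_d}$ inductively free with exponents $(e_1,\dots,e_d)$. *)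

(* Defs.v *)
From HB Require Import structures.
From mathcomp Require Import all_boot all_order all_algebra finmap zify reals.
From mathcomp Require Import mpoly.

Set Implicit Arguments.
Unset Strict Implicit.
Unset Printing Implicit Defensive.

Import GRing.Theory.

Local Open Scope fset_scope.
Local Open Scope ring_scope.

Definition is_derivation (R : realType) (n : nat)
    (theta : {mpoly R[n]} -> {mpoly R[n]}) : Prop :=
  (forall (c : R) (f g : {mpoly R[n]}),
     theta (c *: f + g) = c *: theta f + theta g) /\
  (forall f g : {mpoly R[n]}, theta (f * g) = f * theta g + g * theta f).

(* Polynomial degree: the degree of the coefficients theta(x_i), so that the
   partial derivatives have degree 0 and the Euler derivation has degree 1. *)
Definition derivation_homog (R : realType) (n d : nat)
    (theta : {mpoly R[n]} -> {mpoly R[n]}) : Prop :=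
  forall i : 'I_n, theta 'X_i \is d.-homog.

(* A (central) arrangement in a subspace X of W is a finite set of hyperplanes
   of X, each of them represented as a subspace of W.  Keeping the ambient
   space X explicit lets an arrangement and its restrictions live in the same
   type. *)
Definition central_arrangement (R : realType) (W : vectType R)
    (X : {vspace W}) (A : {fset {vspace W}}) : Prop :=
  forall H, H \in A -> (H <= X)%VS /\ \dim X = (\dim H).+1.

(* In the coordinates x_1, ..., x_n dual to the basis b of the ambient space,
   alpha is a linear form with kernel H. *)
Definition defining_form (R : realType) (W : vectType R) (n : nat)
    (b : n.-tuple W) (H : {vspace W}) (alpha : {mpoly R[n]}) : Prop :=
  alpha \is 1.-homog /\
  forall x : 'I_n -> R, alpha.@[x] = 0 <-> \sum_(i < n) x i *: tnth b i \in H.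

Definition log_derivation (R : realType) (W : vectType R) (n : nat)
    (b : n.-tuple W) (A : {fset {vspace W}})
    (theta : {mpoly R[n]} -> {mpoly R[n]}) : Prop :=
  is_derivation theta /\
  forall (H : {vspace W}) (alpha : {mpoly R[n]}),
    H \in A -> defining_form b H alpha ->
    exists g : {mpoly R[n]}, theta alpha = alpha * g.

Definition log_derivation_basis (R : realType) (W : vectType R) (n k : nat)
    (b : n.-tuple W) (A : {fset {vspace W}})
    (theta : 'I_k -> {mpoly R[n]} -> {mpoly R[n]}) : Prop :=
  [/\ forall i, log_derivation b A (theta i),
      forall c : 'I_k -> {mpoly R[n]},
        (forall f, \sum_(i < k) c i * theta i f = 0) -> forall i, c i = 0
    & forall eta, log_derivation b A eta ->
        exists c : 'I_k -> {mpoly R[n]},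
          forall f, eta f = \sum_(i < k) c i * theta i f].

(* The arrangement A in X is free and e lists its exponents, in some order.
   Neither freeness nor the degrees depend on the linear coordinates on X,
   i.e. on the choice of the basis b. *)
Definition free_with_exponents (R : realType) (W : vectType R)
    (X : {vspace W}) (A : {fset {vspace W}}) (e : seq nat) : Prop :=
  central_arrangement X A /\
  exists (n : nat) (b : n.-tuple W)
    (theta : 'I_(size e) -> {mpoly R[n]} -> {mpoly R[n]}),
    [/\ basis_of X b,
        log_derivation_basis b A theta
      & forall i : 'I_(size e), derivation_homog (nth 0%N e i) (theta i)].

Definition restriction (R : realType) (W : vectType R)
    (A : {fset {vspace W}}) (X : {vspace W}) : {fset {vspace W}} :=
  [fset (H :&: X)%VS | H in A & ~~ (X <= H)%VS].

(* The inclusion of exponents is an inclusion of multisets. *)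
Inductive inductively_free (R : realType) (W : vectType R) :
    {vspace W} -> {fset {vspace W}} -> Prop :=
| InductivelyFree0 (X : {vspace W}) : inductively_free X fset0
| InductivelyFreeAdd (X : {vspace W}) (A : {fset {vspace W}})
    (H : {vspace W}) (e e' : seq nat) :
    central_arrangement X A ->
    H \in A ->
    inductively_free X (A `\ H) ->
    inductively_free H (restriction A H) ->
    free_with_exponents X (A `\ H) e ->
    free_with_exponents H (restriction A H) e' ->
    (forall d, count_mem d e' <= count_mem d e)%N ->
    inductively_free X A.

Definition in_lattice (R : realType) (W : vectType R)
    (A : {fset {vspace W}}) (X : {vspace W}) : Prop :=
  exists2 B : {fset {vspace W}}, B `<=` A & X = (\bigcap_(H <- B) H)%VS.

(* The exponents may be listed in any order: the flag is compared with their
   nondecreasing rearrangement. *)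
Definition ind_flag_accurate (R : realType) (W : vectType R)
    (A : {fset {vspace W}}) (s : seq nat) : Prop :=
  let e := sort leq s in
  let N := \dim {:W} in
  [/\ free_with_exponents fullv A e,
      inductively_free fullv A
    & exists F : nat -> {vspace W},
        [/\ F N = fullv,
            forall d, (0 < d < N)%N -> (F d <= F d.+1)%VS
          & forall d, (0 < d <= N)%N ->
              [/\ in_lattice A (F d),
                  \dim (F d) = d,
                  inductively_free (F d) (restriction A (F d))
                & free_with_exponents (F d) (restriction A (F d))
                    (take d e)]]].

Definition hyperplane (R : realType) (N : nat) (c : 'cV[R]_N) :
    {vspace 'rV[R]_N} :=
  lker (linfun (mulmxr c : 'rV[R]_N -> 'rV[R]_1)).

Lemma mem_hyperplane (R : realType) (N : nat) (c : 'cV[R]_N) (v : 'rV[R]_N) :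
  (v \in hyperplane c) = (v *m c == 0).
Proof. by rewrite memv_ker lfunE. Qed.

(* An affine arrangement in R^l is given by its equations: the pair (a, d)
   stands for the hyperplane a_1 x_1 + ... + a_l x_l = d.  In the cone the
   extra coordinate z comes last. *)
Definition cone (R : realType) (l : nat) (E : seq ('cV[R]_l * R)) :
    {fset {vspace 'rV[R]_(l + 1)}} :=
  hyperplane (col_mx 0 1%:M) |`
    [fset hyperplane (col_mx q.1 (- q.2%:M)) | q in E].

Lemma mem_cone_hyperplane (R : realType) (l : nat) (a : 'cV[R]_l) (d : R)
    (x : 'rV[R]_l) (z : R) :
  (row_mx x z%:M \in hyperplane (col_mx a (- d%:M))) =
  (\sum_(i < l) a i 0 * x 0 i == d * z).
Proof.
rewrite mem_hyperplane mul_row_col mulmxN subr_eq0 mul_scalar_mx.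
have -> : x *m a = (\sum_(i < l) a i 0 * x 0 i)%:M.
  by apply/matrixP => i j; rewrite !ord1 !mxE mulr1n; apply: eq_bigr => k _;
     rewrite mulrC.
apply/eqP/eqP => [/matrixP/(_ 0 0)|->].
  by rewrite !mxE !mulr1n mulrC => ->; rewrite mulrC.
by apply/matrixP => i j; rewrite !ord1 !mxE !mulr1n mulrC.
Qed.

Lemma mem_cone_infinity (R : realType) (l : nat) (x : 'rV[R]_l) (z : R) :
  (row_mx x z%:M \in hyperplane (col_mx 0 1%:M)) = (z == 0).
Proof.
rewrite mem_hyperplane mul_row_col mulmx0 add0r mulmx1.
apply/eqP/eqP => [/matrixP/(_ 0 0)|->]; first by rewrite !mxE mulr1n.
by apply/matrixP => i j; rewrite !mxE mul0rn.
Qed.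

Definition int_range (lo hi : nat) : seq int :=
  [seq k%:Z - lo%:Z | k <- iota 0 (lo + hi).+1].

Lemma mem_int_range (lo hi : nat) (s : int) :
  (s \in int_range lo hi) = (- lo%:Z <= s <= hi%:Z).
Proof.
apply/mapP/andP => [[k]|[h1 h2]].
  by rewrite mem_iota add0n => /andP[_ hk] ->; split; lia.
by exists (absz (s + lo%:Z)); [rewrite mem_iota add0n|]; lia.
Qed.

(* Indices are 0-based: the range 1 <= i <= p becomes i < p. *)
Definition arrE (R : realType) (l p n a m : nat) : seq ('cV[R]_l * R) :=
  [seq (delta_mx ij.1 0 - delta_mx ij.2 0, s%:~R) |
     ij : 'I_l * 'I_l <- [seq ij : 'I_l * 'I_l <- enum predT | (ij.1 < ij.2)%N],
     s : int <- int_range a a] ++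
  [seq (delta_mx i 0, s%:~R) |
     i : 'I_l <- enum 'I_l,
     s : int <- int_range (n * a) (if (i < p)%N then m else m.+1)].

(* Main.v *)
Require Import Defs.
From HB Require Import structures.
From mathcomp Require Import all_boot all_order all_algebra finmap zify reals.
From mathcomp Require Import perm fraction mpoly ring.
From mathcomp Require boolp.

(* Write c for m + a(l + n - 1).  Everything rests on Terao's addition theorem,
   applied to a family of deformations closed under removing the top hyperplane
   x_i = s and under restriction to it: the hyperplanes x_i - x_j = s, |s| <= a,
   together with x_i = lo, ..., lo + t_i - 1.  On x_i = s, each x_i - x_j = s'
   becomes x_j = s - s', so the values of every other x_j become an interval of
   common length; without any x_i = s, the differences x_j - x_i to a fixed x_i
   are the coordinates of a smaller member of the family, and the arrangement
   is its product with a line.  The flag is obtained by restricting repeatedly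
   to the lowest hyperplane x_i = lo, which leaves c unchanged and drops the
   largest exponent.

   In the addition theorem, let z be a form of H, and assume that A' = A - {H}
   has exponents (d, e') and A'' = A^H has exponents e'.  The restrictions of
   theta(z) to H, for theta in D(A'), are all divisible by one form of degree
   |A'| - |A''| = d.  If theta(z) vanished on H for each basis element theta of
   degree at most d, their restrictions would lie in the span of too few basis
   elements of D(A'').  So some basis element of degree d has theta(z) nonzero
   on H; correcting the others by multiples of it and replacing it by z theta
   gives a basis of D(A). *)

Set Implicit Arguments.
Unset Strict Implicit.
Unset Printing Implicit Defensive.

Import Order.TTheory GRing.Theory Num.Theory.

Local Open Scope fset_scope.
Local Open Scope ring_scope.

(** * Divisibility by linear forms *)

Section Polynomials.
Variable R : fieldType.

Lemma mpoly_ind_ring (n : nat) (P : {mpoly R[n]} -> Prop) :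
  (forall c, P c%:MP) -> (forall i, P 'X_i) ->
  (forall f g, P f -> P g -> P (f + g)) ->
  (forall f g, P f -> P g -> P (f * g)) -> forall f, P f.
Proof.
move=> PC PX PD PM f; rewrite [f]mpolyE.
apply: big_ind => // [|m _]; first by rewrite -mpolyC0.
rewrite -mul_mpolyC; apply: (PM _ _ (PC _)); rewrite mpolyXE_id.
apply: big_ind => // [|i _]; first exact: PC.
by elim: (m i) => [|k IH]; [exact: (PC 1) | rewrite exprS; exact: PM].
Qed.

Lemma linear_formE (n : nat) (f : {mpoly R[n]}) :
  f \is 1.-homog -> f = \sum_(i < n) f@_U_(i) *: 'X_i.
Proof.
move=> /dhomogP hf; apply/mpolyP => m; rewrite raddf_sum /=.
under eq_bigr => i _ do rewrite mcoeffZ mcoeffX.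
have [mf|mf] := boolP (m \in msupp f).
  have /eqP/mdeg1P[i /eqP ->] := hf _ mf.
  rewrite (bigD1 i) //= eqxx mulr1 big1 ?addr0 // => j ji.
  case: eqP => [/eqP|]; last by rewrite mulr0.
  by rewrite eq_mnm1 (negPf ji).
rewrite (memN_msupp_eq0 mf) big1 // => i _.
by case: eqP => [mi|]; rewrite ?mulr0 // mulr1 mi memN_msupp_eq0.
Qed.

Lemma comp_mpoly_homog (n k d : nat) (s : n.-tuple {mpoly R[k]})
    (f : {mpoly R[n]}) :
  (forall i, tnth s i \is 1.-homog) -> f \is d.-homog ->
  f \mPo s \is d.-homog.
Proof.
move=> hs /dhomogP hf; rewrite comp_mpolyE big_seq.
apply: rpred_sum => m /hf mf; apply: rpredZ.
rewrite -mf /= mdegE.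
elim/big_ind2: _ => [|x d1 y d2|i _]; first exact: dhomog1.
  by rewrite addnC => h1 h2; rewrite addnC; exact: dhomogM.
by have := dhomogMn (m i) (hs i); rewrite mul1n.
Qed.

(** Multiplication by a form of degree [d] shifts homogeneous components by [d]. This allows the
    coefficients in a relation between homogeneous elements to be replaced by homogeneous ones. *)
Lemma pihomogM (n d e : nat) (f g : {mpoly R[n]}) : f \is d.-homog ->
  pihomog mdeg e (f * g) =
  if (d <= e)%N then f * pihomog mdeg (e - d) g else 0.
Proof.
move=> hf; rewrite [in LHS](mpolyE g) mulr_sumr linear_sum /=.
have term m : pihomog mdeg e (f * (g@_m *: 'X_[m])) =
    if (d + mdeg m == e)%N then f * (g@_m *: 'X_[m]) else 0.
  have fX : f * (g@_m *: 'X_[m]) \is (d + mdeg m).-homog.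
    by apply: dhomogM => //; rewrite dhomogZ // dhomogX.
  case: eqP => [<-|/eqP ne]; first exact: pihomog_dE.
  exact: pihomog_ne0 ne fX.
under eq_bigr => m _ do rewrite term.
rewrite -big_mkcond /=; case: leqP => [de|ed].
  rewrite pihomogE mulr_sumr; apply: eq_bigl => m.
  by rewrite -[in RHS](eqn_add2l d) subnKC.
by rewrite big1 // => m /eqP em; move: ed; rewrite -em ltnNge leq_addr.
Qed.

Definition mdvd (n : nat) (p q : {mpoly R[n]}) := exists g, q = p * g.

Lemma mdvdD n (p f g : {mpoly R[n]}) : mdvd p f -> mdvd p g -> mdvd p (f + g).
Proof. by move=> [u ->] [v ->]; exists (u + v); rewrite mulrDr. Qed.

Lemma mdvdMl n (p f g : {mpoly R[n]}) : mdvd p f -> mdvd p (g * f).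
Proof. by move=> [u ->]; exists (g * u); rewrite mulrCA. Qed.

Lemma mdvdMr n (p f g : {mpoly R[n]}) : mdvd p f -> mdvd p (f * g).
Proof. by move=> [u ->]; exists (u * g); rewrite mulrA. Qed.

Lemma mdvdZ n (p f : {mpoly R[n]}) c : mdvd p f -> mdvd p (c *: f).
Proof. by move=> [u ->]; exists (c *: u); rewrite scalerAr. Qed.

Lemma mdvdN n (p f : {mpoly R[n]}) : mdvd p f -> mdvd p (- f).
Proof. by move=> [u ->]; exists (- u); rewrite mulrN. Qed.

Lemma mdvdB n (p f g : {mpoly R[n]}) : mdvd p f -> mdvd p g -> mdvd p (f - g).
Proof. by move=> h k; apply/mdvdD/mdvdN. Qed.

Lemma mdvd0 n (p : {mpoly R[n]}) : mdvd p 0.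
Proof. by exists 0; rewrite mulr0. Qed.

Lemma mdvd_sum n I (r : seq I) (P : pred I) (p : {mpoly R[n]}) F :
  (forall i, P i -> mdvd p (F i)) -> mdvd p (\sum_(i <- r | P i) F i).
Proof. by move=> h; apply: big_ind => //; [exact: mdvd0 | exact: mdvdD]. Qed.

(** A congruence modulo [p] between ring morphisms need only hold on the variables. With [w] the
    identity it serves to show an ideal prime, with [w] a section of [s] to find the kernel of the
    restriction to a hyperplane. *)
Lemma mdvd_congr_subst n k (p : {mpoly R[n]}) (s : n.-tuple {mpoly R[k]})
    (w : k.-tuple {mpoly R[n]}) :
  (forall i, mdvd p ('X_i - (tnth s i \mPo w))) ->
  forall f, mdvd p (f - ((f \mPo s) \mPo w)).
Proof.
move=> h; elim/mpoly_ind_ring => [c|i|f g hf hg|f g hf hg].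
- by rewrite !comp_mpolyC subrr; exact: mdvd0.
- by rewrite comp_mpolyXU -tnth_nth.
- by rewrite !rmorphD /= opprD addrACA; exact: mdvdD.
rewrite !rmorphM /= -(subrK (g * ((f \mPo s) \mPo w)) (f * g)) -addrA.
rewrite mulrC -mulrBr mulrC [g * _]mulrC -mulrBr.
by apply: mdvdD; [exact: mdvdMr | exact: mdvdMl].
Qed.

(* Substituting for one variable the value that annihilates [p] is a ring
   morphism with kernel [(p)], so that [(p)] is a prime ideal. *)
Lemma linear_form_prime n (p f g : {mpoly R[n]}) : p \is 1.-homog -> p != 0 ->
  mdvd p (f * g) -> mdvd p f \/ mdvd p g.
Proof.
move=> p1 p0 [h fgE].
have [i0 pi0] : exists i, p@_U_(i) != 0.
  apply/existsP; apply: contraR p0 => /existsPn h0.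
  rewrite (linear_formE p1) big1 // => i _.
  by move: (h0 i); rewrite negbK => /eqP ->; rewrite scale0r.
pose s := [tuple 'X_i - (i == i0)%:R *: ((p@_U_(i0))^-1 *: p) | i < n].
have sE i : tnth s i = 'X_i - (i == i0)%:R *: ((p@_U_(i0))^-1 *: p).
  by rewrite tnth_mktuple.
have ps : p \mPo s = 0.
  rewrite {1}(linear_formE p1) linear_sum /=.
  under eq_bigr => i _ do
    rewrite linearZ /= comp_mpolyXU -tnth_nth sE scalerBr.
  rewrite sumrB -linear_formE // (bigD1 i0) //= eqxx scale1r scalerA.
  rewrite divff // scale1r big1 ?addr0 ?subrr // => i /negPf ->.
  by rewrite scale0r scaler0.
have cong u : mdvd p (u - (u \mPo s)).
  rewrite -[u \mPo s]comp_mpoly_id; apply: mdvd_congr_subst => i.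
  rewrite comp_mpoly_id sE opprB addrC subrK.
  by do 2!apply: mdvdZ; exists 1; rewrite mulr1.
have /eqP : (f \mPo s) * (g \mPo s) = 0.
  by rewrite -rmorphM fgE rmorphM /= ps mul0r.
rewrite mulf_eq0 => /orP[] /eqP u0; [left|right].
  by move: (cong f); rewrite u0 subr0.
by move: (cong g); rewrite u0 subr0.
Qed.

Definition mcoprime n (p q : {mpoly R[n]}) :=
  forall g, mdvd p (q * g) -> mdvd p g.

Lemma mcoprime_linear n (p q : {mpoly R[n]}) : p \is 1.-homog -> p != 0 ->
  ~ mdvd p q -> mcoprime p q.
Proof. by move=> p1 p0 npq g /(linear_form_prime p1 p0)[]. Qed.

Lemma mcoprimeMr n (p q1 q2 : {mpoly R[n]}) :
  mcoprime p q1 -> mcoprime p q2 -> mcoprime p (q1 * q2).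
Proof. by move=> h1 h2 g; rewrite -mulrA => /h1/h2. Qed.

Lemma mcoprimeXr n (p q : {mpoly R[n]}) k : mcoprime p q -> mcoprime p (q ^+ k).
Proof.
move=> h; elim: k => [g|k IH]; first by rewrite mul1r.
by rewrite exprS; exact: mcoprimeMr.
Qed.

Lemma mcoprimeXl n (p q : {mpoly R[n]}) k : p != 0 ->
  mcoprime p q -> mcoprime (p ^+ k) q.
Proof.
move=> p0 h; elim: k => [|k IH] g; first by exists g; rewrite mul1r.
rewrite exprS => - [u]; rewrite -mulrA => qgE.
have [|v gE] := h g; first by exists (p ^+ k * u).
have : mdvd (p ^+ k) (q * v).
  by exists u; apply: (mulfI p0); rewrite -qgE gE mulrCA.
by move=> /IH[w vE]; exists w; rewrite gE vE mulrA.
Qed.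

(** After [F i] is split off, coprimality passes the other divisors on to the cofactor, to which the
    induction applies. *)
Lemma mdvd_prod n (I : eqType) (s : seq I) (F : I -> {mpoly R[n]}) f :
  uniq s ->
  {in s &, forall i j, i != j -> mcoprime (F i) (F j)} ->
  {in s, forall i, mdvd (F i) f} -> mdvd (\prod_(i <- s) F i) f.
Proof.
elim: s f => [|i s IH] f /=; first by exists f; rewrite big_nil mul1r.
move=> /andP[nis us] cop dv; have [g fE] := dv i (mem_head _ _).
have [|j js|u gE] := IH g us.
- by move=> j k js ks; apply: cop; rewrite inE ?js ?ks orbT.
- apply: (cop j i); rewrite ?mem_head ?inE ?js ?orbT //.
    by apply: contraNneq nis => <-.
  by rewrite -fE; apply: dv; rewrite inE js orbT.
by exists u; rewrite big_cons fE gE mulrA.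
Qed.

Lemma frac_clear_denom (S : idomainType) (x : {fraction S}) :
  exists nd : S * S, nd.2 != 0 /\ tofrac nd.2 * x = tofrac nd.1.
Proof.
elim/quotW: x => y; exists (\n_y, \d_y); split; first exact: denom_ratioP.
unlock tofrac; rewrite -[LHS]FracField.pi_mul; apply/eqmodP => /=.
by rewrite FracField.equivfE /= !numden_Ratio ?mulf_neq0 ?oner_eq0
  ?denom_ratioP // mulr1 mul1r.
Qed.

(** Over the fraction field, [n.+1] rows of length [n] are dependent; a common denominator brings
    the relation back into [S]. *)
Lemma idomain_kernel (S : idomainType) n (A : 'M[S]_(n.+1, n)) :
  exists2 v : 'rV[S]_n.+1, v != 0 & v *m A = 0.
Proof.
pose B := map_mx (@tofrac S) A.
have : kermx B != 0.
  rewrite kermx_eq0 /row_free neq_ltn.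
  by apply/orP; left; rewrite ltnS rank_leq_col.
move=> /rowV0Pn[u /sub_kermxP uB u0].
have [nd hnd] := fin_all_exists (fun j => frac_clear_denom (u 0 j)).
pose d := \prod_(j < n.+1) (nd j).2.
pose v := \row_j ((nd j).1 * \prod_(k < n.+1 | k != j) (nd k).2).
have d0 : tofrac d != 0.
  rewrite tofrac_eq0 prodf_seq_neq0; apply/allP => j _ /=.
  by case: (hnd j).
have vE : map_mx (@tofrac S) v = tofrac d *: u.
  apply/rowP => j; rewrite !mxE.
  have -> : d = (nd j).2 * \prod_(k < n.+1 | k != j) (nd k).2.
    by rewrite /d (bigD1 j).
  by rewrite !tofracM mulrAC; congr (_ * _); case: (hnd j).
exists v.
  apply: contraNneq u0 => v0; move/eqP: vE; rewrite v0 map_mx0 eq_sym.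
  by rewrite scaler_eq0 (negPf d0).
have : map_mx (@tofrac S) (v *m A) = 0.
  by rewrite map_mxM vE -scalemxAl uB scaler0.
move=> /matrixP vA; apply/matrixP => i j; move/eqP: (vA i j).
by rewrite !mxE tofrac_eq0 => /eqP.
Qed.

End Polynomials.

(** * Derivations and defining forms *)

Section Derivations.
Variables (R : realType) (n : nat).
Local Notation S := {mpoly R[n]}.
Implicit Types (f g : S).

Lemma mderivXU i j : ('X_j : S)^`M(i) = (i == j)%:R.
Proof.
rewrite mderivX mnm1E eq_sym; case: eqP => [->|_]; last by rewrite scale0r.
rewrite scale1r (_ : (U_(j) - U_(j) = 0)%MM) ?mpolyX0 //.
by apply/mnmP => k; rewrite mnmBE subnn mnm0E.
Qed.

Section Basics.
Variable th : S -> S.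
Hypothesis dth : is_derivation th.

Lemma derivationD f g : th (f + g) = th f + th g.
Proof. by have := dth.1 1 f g; rewrite !scale1r. Qed.

Lemma derivation0 : th 0 = 0.
Proof. by apply: (addrI (th 0)); rewrite -derivationD !addr0. Qed.

Lemma derivationZ c f : th (c *: f) = c *: th f.
Proof. by have := dth.1 c f 0; rewrite derivation0 !addr0. Qed.

Lemma derivation_sum I (r : seq I) (P : pred I) (F : I -> S) :
  th (\sum_(i <- r | P i) F i) = \sum_(i <- r | P i) th (F i).
Proof. by apply: big_morph; [exact: derivationD | exact: derivation0]. Qed.

Lemma derivationC c : th c%:MP = 0.
Proof.
rewrite -[c%:MP]mulr1 mul_mpolyC derivationZ.
have := dth.2 1 1; rewrite !mul1r -[X in X = _]addr0 => /addrI <-.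
by rewrite scaler0.
Qed.

Lemma derivationE f : th f = \sum_(i < n) th 'X_i * f^`M(i).
Proof.
move: f; apply: mpoly_ind_ring => [c|i|f g hf hg|f g hf hg].
- rewrite derivationC big1 // => i _; by rewrite mderivC mulr0.
- rewrite (bigD1 i) //= mderivXU eqxx mulr1 big1 ?addr0 // => j ji.
  by rewrite mderivXU (negPf ji) mulr0.
- rewrite derivationD hf hg -big_split; apply: eq_bigr => i _.
  by rewrite mderivD mulrDr.
rewrite dth.2 hf hg !mulr_sumr -big_split; apply: eq_bigr => i _ /=.
rewrite mderivM mulrDr [in RHS]addrC; congr (_ + _);
  by rewrite ?[f^`M(i) * g]mulrC mulrCA.
Qed.

Lemma derivation_homog_form d f :
  derivation_homog d th -> f \is 1.-homog -> th f \is d.-homog.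
Proof.
move=> hd /linear_formE ->; rewrite derivation_sum rpred_sum // => i _.
by rewrite derivationZ rpredZ ?hd.
Qed.

End Basics.

Lemma derivation_lincomb k (c : 'I_k -> S) (th : 'I_k -> S -> S) :
  (forall i, is_derivation (th i)) ->
  is_derivation (fun f => \sum_(i < k) c i * th i f).
Proof.
move=> dth; split=> [a f g|f g].
  rewrite scaler_sumr -big_split; apply: eq_bigr => i _ /=.
  by rewrite (dth i).1 mulrDr scalerAr.
rewrite !mulr_sumr -big_split; apply: eq_bigr => i _ /=.
by rewrite (dth i).2 mulrDr !(mulrCA (c i)).
Qed.

Lemma derivation_mderiv (v : 'I_n -> S) :
  is_derivation (fun f => \sum_(i < n) v i * f^`M(i)).
Proof.
apply: derivation_lincomb => i; split=> [a f g|f g].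
  by rewrite mderivD mderivZ.
by rewrite mderivM addrC [f^`M(i) * g]mulrC.
Qed.

Lemma sum_mderivX (v : 'I_n -> S) j : \sum_(i < n) v i * 'X_j^`M(i) = v j.
Proof.
rewrite (bigD1 j) //= mderivXU eqxx mulr1 big1 ?addr0 // => i ij.
by rewrite mderivXU (negPf ij) mulr0.
Qed.

Lemma derivation_ext (th ps : S -> S) : is_derivation th -> is_derivation ps ->
  (forall i, th 'X_i = ps 'X_i) -> th =1 ps.
Proof.
move=> dt dp h f; rewrite (derivationE dt) (derivationE dp).
by apply: eq_bigr => i _; rewrite h.
Qed.

Lemma homog0C f : f \is 0.-homog -> exists c, f = c%:MP.
Proof.
move=> /dhomogP hf; exists (f@_0%MM); apply/mpolyP => m; rewrite mcoeffC.
case: eqP => [<-|/eqP m0]; first by rewrite mulr1.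
rewrite mulr0 memN_msupp_eq0 //; apply: contra m0 => /hf /= /eqP.
by rewrite mdeg_eq0 eq_sym.
Qed.

Lemma meval_form f x : f \is 1.-homog -> f.@[x] = \sum_(i < n) x i * f@_U_(i).
Proof.
move=> /linear_formE {1}->; rewrite raddf_sum; apply: eq_bigr => i _ /=.
by rewrite mevalZ mevalXU mulrC.
Qed.

Lemma form_eq f g : f \is 1.-homog -> g \is 1.-homog ->
  (forall x, f.@[x] = g.@[x]) -> f = g.
Proof.
move=> f1 g1 fg; rewrite (linear_formE f1) (linear_formE g1).
apply: eq_bigr => i _; congr (_ *: _).
have ev (h : S) : h \is 1.-homog -> h.@[fun j => (j == i)%:R] = h@_U_(i).
  move=> h1; rewrite meval_form // (bigD1 i) //= eqxx mul1r big1 ?addr0 // => j.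
  by move=> /negPf ->; rewrite mul0r.
by rewrite -!ev.
Qed.

End Derivations.

(** Substituting [w] and then [s] changes nothing, so the coefficients in the Leibniz rule come back
    intact. This covers changes of coordinates as well as the derivation induced on a hyperplane,
    where [s] has a kernel. *)
Lemma derivation_section (R : realType) n k (s : n.-tuple {mpoly R[k]})
    (w : k.-tuple {mpoly R[n]}) (th : {mpoly R[n]} -> {mpoly R[n]}) :
  (forall f, (f \mPo w) \mPo s = f) -> is_derivation th ->
  is_derivation (fun f => th (f \mPo w) \mPo s).
Proof.
move=> sw dth; split=> [c f g|f g].
  by rewrite comp_mpolyD comp_mpolyZ dth.1 comp_mpolyD comp_mpolyZ.
by rewrite rmorphM /= dth.2 rmorphD !rmorphM /= !sw.
Qed.

Lemma comp_mpoly_eq_id (R : realType) n k (s : n.-tuple {mpoly R[k]})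
    (w : k.-tuple {mpoly R[n]}) :
  (forall i, tnth w i \mPo s = 'X_i) -> forall f, (f \mPo w) \mPo s = f.
Proof.
move=> h; apply: mpoly_ind_ring => [c|i|f g hf hg|f g hf hg].
- by rewrite !comp_mpolyC.
- by rewrite comp_mpolyXU -tnth_nth.
- by rewrite !rmorphD /= hf hg.
by rewrite !rmorphM /= hf hg.
Qed.

(** * Hyperplanes and their linear forms *)

Section Forms.
Variables (R : realType) (W : vectType R).
Implicit Types (X H K : {vspace W}) (phi : 'Hom(W, R^o)).

(** [K] has a one-dimensional complement in [X]; the functional reads off the component along it. *)
Lemma hyperplane_functional X K : (K <= X)%VS -> \dim X = (\dim K).+1 ->
  exists phi : {scalar W}, {in X, forall x, (x \in K) = (phi x == 0)}.
Proof.
move=> KX dX; pose u := vpick (X :\: K).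
have dU : \dim (X :\: K) = 1%N.
  by have := dimv_cap_compl X K; rewrite (capv_idPr KX) dX -addn1 => /addnI.
have u0 : u != 0 by rewrite vpick0 -dimv_eq0 dU.
have uE : (X :\: K)%VS = <[u]>%VS.
  apply/esym/eqP; rewrite eqEdim dU dim_vline u0 andbT.
  by rewrite -memvE memv_pick.
have KU0 : (<[u]> :&: K)%VS = 0%VS by rewrite -uE capv_diff.
pose phi : {scalar W} := coord [tuple u] ord0 \o daddv_pi <[u]> K.
exists phi => x xX.
have xUK : x \in (<[u]> + K)%VS by rewrite -uE addv_diff (addv_idPl KX).
have xE := daddv_pi_add KU0 xUK.
have piE : daddv_pi <[u]> K x = phi x *: u.
  have : daddv_pi <[u]> K x \in <<[tuple u]>>%VS by rewrite span_seq1 memv_pi.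
  by move=> /coord_span; rewrite big_ord1.
apply/idP/eqP => [xK|phi0].
  have : phi x *: u \in (<[u]> :&: K)%VS.
    rewrite memv_cap memvZ ?memv_line //= -piE.
    by rewrite -(addrK (daddv_pi K <[u]> x) (daddv_pi _ _ _)) xE memvB ?memv_pi.
  by rewrite KU0 memv0 scaler_eq0 (negPf u0) orbF => /eqP.
by rewrite -xE piE phi0 scale0r add0r memv_pi.
Qed.


Lemma defining_form_scalar X n (b : n.-tuple W) K (phi : {scalar W}) :
  basis_of X b -> {in X, forall x, (x \in K) = (phi x == 0)} ->
  defining_form b K (\sum_(i < n) phi (tnth b i) *: 'X_i).
Proof.
move=> bX phiK; split=> [|x].
  by apply: rpred_sum => i _; rewrite rpredZ // dhomogX /= mdeg1.
have xX : \sum_(i < n) x i *: tnth b i \in X.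
  by apply: memv_suml => i _; rewrite memvZ // (basis_mem bX) // mem_tnth.
rewrite phiK // !linear_sum /=.
rewrite [X in X = 0 <-> _](_ : _ = \sum_(i < n) phi (x i *: tnth b i)).
  by split=> [->|/eqP]; rewrite ?eqxx.
by apply: eq_bigr => i _; rewrite mevalZ mevalXU linearZ /= mulrC.
Qed.

Section Uniqueness.
Variables (n : nat) (b : n.-tuple W) (X : {vspace W}).
Hypothesis bX : basis_of X b.

Lemma basis_point v : v \in X ->
  exists x : 'I_n -> R, v = \sum_i x i *: tnth b i.
Proof.
move=> /(coord_basis bX) vE; exists (coord b ^~ v); rewrite {1}vE.
by apply: eq_bigr => i _; rewrite (tnth_nth 0).
Qed.

Lemma defining_form_exists K : (K <= X)%VS -> \dim X = (\dim K).+1 ->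
  exists f, defining_form b K f.
Proof.
move=> KX dK; have [phi hphi] := hyperplane_functional KX dK.
by eexists; apply: defining_form_scalar bX hphi.
Qed.

Lemma defining_form_sep K f : defining_form b K f -> ~~ (X <= K)%VS ->
  exists x, f.@[x] != 0.
Proof.
move=> [_ fK] /subvPn[v vX vK].
have [x vE] := basis_point vX; exists x.
by apply: contraNneq vK; rewrite vE => /fK.
Qed.

Lemma defining_form_neq0 K f : defining_form b K f -> ~~ (X <= K)%VS -> f != 0.
Proof.
move=> fK KX; have [x] := defining_form_sep fK KX.
by apply: contraNneq => ->; rewrite meval0.
Qed.

Lemma defining_formZ K f c : c != 0 -> defining_form b K f ->
  defining_form b K (c *: f).
Proof.
move=> c0 [f1 fK]; split=> [|x]; first by rewrite rpredZ.
rewrite mevalZ -fK; split=> [/eqP|->]; last by rewrite mulr0.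
by rewrite mulf_eq0 (negPf c0) => /eqP.
Qed.

Lemma defining_form_uniq K f g : defining_form b K f -> defining_form b K g ->
  ~~ (X <= K)%VS -> exists2 c, c != 0 & g = c *: f.
Proof.
move=> fK gK KX; have [u fu] := defining_form_sep fK KX.
have gu : g.@[u] != 0.
  by apply: contraNneq fu => /gK.2/fK.2 ->.
exists (g.@[u] / f.@[u]); first by rewrite mulf_neq0 ?invr_eq0.
have [f1 g1] := (fK.1, gK.1).
apply: form_eq; rewrite ?rpredZ // => x; rewrite mevalZ.
(* [y] is [x] moved along [u] into the kernel of [f]; there [g] vanishes too, and expanding [g] at
   [y] gives the proportionality. *)
pose y i := x i - f.@[x] / f.@[u] * u i.
have ev h : h \is 1.-homog -> h.@[y] = h.@[x] - f.@[x] / f.@[u] * h.@[u].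
  move=> h1; rewrite !(meval_form _ h1) mulr_sumr -sumrB; apply: eq_bigr => i _.
  by rewrite mulrBl mulrA.
have : f.@[y] = 0 by rewrite ev // divfK ?subrr.
move=> /fK.2/gK.2/eqP; rewrite ev // subr_eq0 => /eqP ->.
by rewrite mulrAC [RHS]mulrC mulrA.
Qed.

(** If [f] divided [g], then [g] would vanish on [K], so that [K] would lie in [K'] and equal it by
    dimension. Primality of [f] does the rest. *)
Lemma defining_form_coprime K K' f g : (K <= X)%VS -> ~~ (X <= K)%VS ->
  \dim K = \dim K' -> K != K' -> defining_form b K f -> defining_form b K' g ->
  mcoprime f g.
Proof.
move=> KX KX' dK nKK' fK gK'.
apply: mcoprime_linear (defining_form_neq0 fK KX') _; first exact: fK.1.
move=> [h gE]; have nKsub : ~~ (K <= K')%VS.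
  by apply: contra nKK' => KK'; rewrite eqEdim KK' dK leqnn.
have /subvPn[v vK vK'] := nKsub.
have [x vE] := basis_point (subvP KX _ vK).
case/negP: vK'; rewrite vE; apply/gK'.2; rewrite gE rmorphM /=.
by rewrite (fK.2 x).2 ?mul0r // -vE.
Qed.

End Uniqueness.

End Forms.

(** * Freeness *)

Section Freeness.
Variables (R : realType) (W : vectType R).
Implicit Types (X H K : {vspace W}) (A : {fset {vspace W}}).

Lemma free_with_exponentsI X A (e : seq nat) n k (b : n.-tuple W)
    (th : 'I_k -> {mpoly R[n]} -> {mpoly R[n]}) :
  central_arrangement X A -> basis_of X b -> size e = k ->
  log_derivation_basis b A th ->
  (forall i : 'I_k, derivation_homog (nth 0%N e i) (th i)) ->
  free_with_exponents X A e.
Proof.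
move=> cA bX ek; case: k / ek th => th lth hth.
by split=> //; exists n, b, th.
Qed.

(** Entry [j] is the [j]-th coordinate for [b] written in the coordinates for [b'], so substituting
    this tuple keeps the polynomial function and changes its coordinates. *)
Definition change_basis n (b b' : n.-tuple W) : n.-tuple {mpoly R[n]} :=
  [tuple \sum_(i < n) coord b j (tnth b' i) *: 'X_i | j < n].

Section ChangeOfBasis.
Variables (X : {vspace W}) (n : nat).
Implicit Types b : n.-tuple W.

Lemma change_basis_homog b b' d f : f \is d.-homog ->
  f \mPo change_basis b b' \is d.-homog.
Proof.
apply: comp_mpoly_homog => j; rewrite tnth_mktuple.
by apply: rpred_sum => i _; rewrite rpredZ // dhomogX /= mdeg1.
Qed.

Lemma change_basisK b b' : basis_of X b -> basis_of X b' ->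
  forall f, (f \mPo change_basis b b') \mPo change_basis b' b = f.
Proof.
move=> bX bX'; apply: comp_mpoly_eq_id => j.
rewrite tnth_mktuple linear_sum /=.
under eq_bigr => i _ do
  rewrite linearZ /= comp_mpolyXU -tnth_nth tnth_mktuple scaler_sumr.
rewrite exchange_big /=.
transitivity (\sum_(k < n) (k == j)%:R *: ('X_k : {mpoly R[n]})).
  apply: eq_bigr => k _; under eq_bigr => i _ do rewrite scalerA.
  rewrite -scaler_suml; congr (_ *: _).
  rewrite -(coord_free k j (basis_free bX)) -(tnth_nth 0 b k).
  rewrite [in RHS](coord_basis bX' (_ : tnth b k \in X)).
    rewrite linear_sum; apply: eq_bigr => i _ /=.
    by rewrite linearZ /= mulrC (tnth_nth 0 b').
  by rewrite (basis_mem bX) // mem_tnth.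
rewrite (bigD1 j) //= eqxx scale1r big1 ?addr0 // => k.
by move=> /negPf ->; rewrite scale0r.
Qed.

Lemma change_basis_form b b' K f : basis_of X b -> basis_of X b' ->
  defining_form b K f -> defining_form b' K (f \mPo change_basis b b').
Proof.
move=> bX bX' [f1 fK]; split=> [|x]; first exact: change_basis_homog.
rewrite comp_mpoly_meval fK.
suff -> : \sum_(i < n) x i *: tnth b' i =
  \sum_(i < n) (tnth (change_basis b b') i).@[x] *: tnth b i by [].
under [RHS]eq_bigr => j _.
  rewrite tnth_mktuple raddf_sum /=.
  under eq_bigr => i _ do rewrite mevalZ mevalXU mulrC.
  rewrite scaler_suml.
  over.
rewrite exchange_big /=; apply: eq_bigr => i _.
under eq_bigr => j _ do rewrite -scalerA (tnth_nth 0 b).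
by rewrite -scaler_sumr -(coord_basis bX) // (basis_mem bX') // mem_tnth.
Qed.

Lemma log_derivation_change b b' A th : basis_of X b -> basis_of X b' ->
  log_derivation b A th ->
  log_derivation b' A
    (fun f => th (f \mPo change_basis b' b) \mPo change_basis b b').
Proof.
move=> bX bX' [dth lth]; split.
  by apply: derivation_section dth; exact: change_basisK.
move=> K f KA fK; have [g gE] := lth _ _ KA (change_basis_form bX' bX fK).
by exists (g \mPo change_basis b b'); rewrite gE rmorphM /= change_basisK.
Qed.

End ChangeOfBasis.

(** Freeness does not depend on coordinates: conjugation with the substitution carries logarithmic
    derivations, relations and degrees from one basis of [X] to any other. *)
Lemma free_with_exponentsE X A (e : seq nat) n k (b : n.-tuple W) :
  free_with_exponents X A e -> size e = k -> basis_of X b ->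
  exists th : 'I_k -> {mpoly R[n]} -> {mpoly R[n]},
    log_derivation_basis b A th /\
    forall i : 'I_k, derivation_homog (nth 0%N e i) (th i).
Proof.
move=> [cA [m [b' [th [bX' lth hth]]]]] ek bX; subst k.
have nm : m = n by rewrite -(vector.size_basis bX) -(vector.size_basis bX').
subst m; have [lth1 lth2 lth3] := lth.
pose s f := f \mPo change_basis b' b; pose t f := f \mPo change_basis b b'.
have stK f : s (t f) = f by exact: change_basisK bX bX' f.
have tsK f : t (s f) = f by exact: change_basisK bX' bX f.
have sD : {morph s : f g / f + g} by exact: comp_mpolyD.
have sM : {morph s : f g / f * g} by exact: rmorphM.
have tM : {morph t : f g / f * g} by exact: rmorphM.
have ssum (F : _ -> _) : s (\sum_i F i) = \sum_(i < size e) s (F i).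
  exact: raddf_sum.
have tsum (F : _ -> _) : t (\sum_i F i) = \sum_(i < size e) t (F i).
  exact: raddf_sum.
exists (fun i f => s (th i (t f))); split; last first.
  move=> i j; apply: change_basis_homog.
  apply: (derivation_homog_form (lth1 i).1 (hth i)).
  by apply: change_basis_homog; rewrite dhomogX /= mdeg1.
split=> [i|c hc i|eta heta].
- exact: log_derivation_change bX' bX (lth1 i).
- have : t (c i) = 0.
    apply: (lth2 (t \o c)) => f; have := congr1 t (hc (s f)).
    rewrite tsum [t 0]comp_mpoly0 => h; rewrite -[RHS]h.
    apply: eq_bigr => j _ /=.
    by rewrite tM !tsK.
  by move=> /(congr1 s); rewrite stK => ->; exact: raddf0.
have [c hc] := lth3 _ (log_derivation_change bX bX' heta).
exists (s \o c) => f; have := congr1 s (hc (t f)).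
rewrite -/(s _) -/(t _) !stK => ->; rewrite ssum.
by apply: eq_bigr => j _; rewrite sM.
Qed.

Lemma free_with_exponents_perm X A e e' : perm_eq e e' ->
  free_with_exponents X A e -> free_with_exponents X A e'.
Proof.
move=> ee' fA; have bX := vbasisP X.
have se := perm_size ee'.
have [th [[lth1 lth2 lth3] hth]] := free_with_exponentsE fA se bX.
have /tuple_permP[p pE] : perm_eq (in_tuple e') (tcast se (in_tuple e)).
  by rewrite perm_sym val_tcast.
have pnth (i : 'I_(size e')) : nth 0%N e' i = nth 0%N e (p i).
  have /= -> := congr1 (nth 0%N ^~ i) pE.
  rewrite (nth_map i) ?size_enum_ord // nth_ord_enum.
  by rewrite (tnth_nth 0%N) val_tcast.
apply: (free_with_exponentsI (k := size e') fA.1 bX (th := th \o p)) => //;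
  last first.
  by move=> i; rewrite pnth; exact: hth.
split=> [i|c hc i|eta /lth3[c hc]] /=; first exact: lth1.
  rewrite -[i](permK p); apply: (lth2 (c \o (p^-1)%g)) => f.
  rewrite -[RHS](hc f) (reindex_inj (@perm_inj _ p)) /=.
  by apply: eq_bigr => j _; rewrite permK.
exists (c \o p) => f; rewrite hc (reindex_inj (@perm_inj _ p)).
by [].
Qed.

Lemma free_with_exponents_empty X :
  free_with_exponents X fset0 (nseq (\dim X) 0%N).
Proof.
apply: (free_with_exponentsI (k := \dim X) _ (vbasisP X)
  (th := fun i f => f^`M(i))).
- by move=> K; rewrite in_fset0.
- exact: size_nseq.
- split=> [i|c hc i|eta [deta _]].
  + split=> [|K f]; last by rewrite in_fset0.
    split=> [a f g|f g]; first by rewrite mderivD mderivZ.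
    by rewrite mderivM addrC [f^`M(i) * g]mulrC.
  + by rewrite -(hc 'X_i) sum_mderivX.
  by exists (fun i => eta 'X_i) => f; exact: derivationE.
by move=> i j; rewrite nth_nseq ltn_ord mderivXU; case: eqP => _;
  [exact: dhomog1 | exact: dhomog0].
Qed.

(** An elementary operation on bases; [u i = 0] keeps [th i] fixed, so that adding the multiples
    back inverts it. *)
Lemma log_derivation_basis_transvect n k (b : n.-tuple W) A
    (th : 'I_k -> {mpoly R[n]} -> {mpoly R[n]}) i u : u i = 0 ->
  log_derivation_basis b A th ->
  log_derivation_basis b A (fun j f => th j f - u j * th i f).
Proof.
move=> ui0 [lth1 lth2 lth3].
have sumE c f : \sum_j c j * (th j f - u j * th i f) =
    \sum_j c j * th j f - (\sum_j c j * u j) * th i f.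
  rewrite mulr_suml -sumrB; apply: eq_bigr => j _.
  by rewrite mulrBr mulrA.
have addE c v f : \sum_j (c j + (j == i)%:R * v) * th j f =
    \sum_j c j * th j f + v * th i f.
  under eq_bigr => j _ do rewrite mulrDl.
  rewrite big_split; congr (_ + _); rewrite (bigD1 i) //= eqxx mul1r.
  by rewrite big1 ?addr0 // => j /negPf ->; rewrite !mul0r.
split=> [j|c hc|eta /lth3[c hc]].
- split=> [|K f KA fK]; last first.
    apply: mdvdB; first exact: (lth1 j).2 KA fK.
    by apply: mdvdMl; exact: (lth1 i).2 KA fK.
  have [[dj1 dj2] [di1 di2]] := ((lth1 j).1, (lth1 i).1).
  split=> [a f g|f g]; rewrite ?dj1 ?di1 ?dj2 ?di2.
    rewrite mulrDr scalerBr opprD addrACA; congr (_ - _ + _).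
    by rewrite scalerAr.
  rewrite !mulrBr mulrDr opprD addrACA; congr (_ - _ + (_ - _)).
    by rewrite mulrCA.
  by rewrite mulrCA.
- have c0 j : j != i -> c j = 0.
    move=> ji; have := lth2 (fun j => c j + (j == i)%:R * - (\sum_j c j * u j)).
    move=> /(_ _ j); rewrite (negPf ji) mul0r addr0; apply => f.
    by rewrite addE mulNr -sumE hc.
  have su : \sum_j c j * u j = 0.
    apply: big1 => j _; have [->|/c0 ->] := eqVneq j i; last by rewrite mul0r.
    by rewrite ui0 mulr0.
  by apply: lth2 => f; have := hc f; rewrite sumE su mul0r subr0.
exists (fun j => c j + (j == i)%:R * (\sum_j c j * u j)) => f.
rewrite hc sumE addE -addrA -mulrBl.
have -> : \sum_j (c j + (j == i)%:R * (\sum_k c k * u k)) * u j =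
    \sum_j c j * u j.
  apply: eq_bigr => j _; have [->|_] := eqVneq j i; last by rewrite mul0r addr0.
  by rewrite ui0 !mulr0.
by rewrite subrr mul0r addr0.
Qed.

End Freeness.

(** * The addition theorem *)

Section Restriction.
Variables (R : realType) (W : vectType R).
Implicit Types (X H K L : {vspace W}) (A : {fset {vspace W}}).

Lemma restrictionP A X L :
  reflect (exists K, [/\ K \in A, ~~ (X <= K)%VS & L = (K :&: X)%VS])
    (L \in restriction A X).
Proof.
apply: (iffP (imfsetP _ _ _ _)) => [[K /=]|[K [KA XK ->]]].
  by rewrite inE => /andP[KA XK] ->; exists K.
by exists K; rewrite //= inE KA.
Qed.

End Restriction.

(** * Restriction of polynomials to a coordinate hyperplane *)

Section PolynomialRestriction.
Variables (R : realType) (n : nat).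
Local Notation S := {mpoly R[n.+1]}.
Local Notation S0 := {mpoly R[n]}.
Local Notation z := ('X_ord0 : S).

Definition restr_tuple : n.+1.-tuple S0 :=
  [tuple if unlift ord0 i is Some j then 'X_j else 0 | i < n.+1].
Definition ext_tuple : n.-tuple S := [tuple 'X_(lift ord0 j) | j < n].

Local Notation rho f := (f \mPo restr_tuple).
Local Notation ext f := (f \mPo ext_tuple).

Lemma restrX0 : rho z = 0.
Proof. by rewrite comp_mpolyXU -tnth_nth tnth_mktuple unlift_none. Qed.

Lemma restrXS j : rho 'X_(lift ord0 j) = 'X_j.
Proof. by rewrite comp_mpolyXU -tnth_nth tnth_mktuple liftK. Qed.

Lemma extX j : ext 'X_j = 'X_(lift ord0 j).
Proof. by rewrite comp_mpolyXU -tnth_nth tnth_mktuple. Qed.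

Lemma extK f : rho (ext f) = f.
Proof. by apply: comp_mpoly_eq_id => j; rewrite tnth_mktuple restrXS. Qed.

Lemma restr_congr f : mdvd z (f - ext (rho f)).
Proof.
apply: mdvd_congr_subst => i; rewrite tnth_mktuple.
case: unliftP => [j ->|->]; first by rewrite extX subrr; exact: mdvd0.
by rewrite comp_mpoly0 subr0; exists 1; rewrite mulr1.
Qed.

Lemma restr_eq0 f : mdvd z f <-> rho f = 0.
Proof.
split=> [[g ->]|f0]; first by rewrite rmorphM /= restrX0 mul0r.
by have := restr_congr f; rewrite f0 comp_mpoly0 subr0.
Qed.

Lemma restr_homog d f : f \is d.-homog -> rho f \is d.-homog.
Proof.
apply: comp_mpoly_homog => i; rewrite tnth_mktuple.
by case: unlift => [j|]; rewrite ?dhomog0 // dhomogX /= mdeg1.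
Qed.

Lemma ext_homog d f : f \is d.-homog -> ext f \is d.-homog.
Proof.
by apply: comp_mpoly_homog => i; rewrite tnth_mktuple dhomogX /= mdeg1.
Qed.

Lemma mpolyX_neq0 i : ('X_i : S) != 0.
Proof.
apply/eqP => /(congr1 (mcoeff U_(i)%MM)).
by rewrite mcoeffX eqxx mcoeff0 => /eqP; rewrite oner_eq0.
Qed.

End PolynomialRestriction.

Arguments restr_tuple {R n}.
Arguments ext_tuple {R n}.
Local Notation rho f := (f \mPo restr_tuple).
Local Notation ext f := (f \mPo ext_tuple).

Section Addition.
Variables (R : realType) (W : vectType R) (X H : {vspace W}).
Variables (A : {fset {vspace W}}) (n : nat) (b' : n.-tuple W) (v : W).
(** In this adapted basis the first coordinate [z] is a form of [H], and the others restrict to the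
    coordinates on [H] dual to [b']. *)
Let b : n.+1.-tuple W := [tuple of v :: b'].
Hypotheses (bX : basis_of X b) (bH : basis_of H b').
Hypotheses (cA : central_arrangement X A) (HA : H \in A).
Hypothesis cH : central_arrangement H (restriction A H).

Local Notation S := {mpoly R[n.+1]}.
Local Notation S0 := {mpoly R[n]}.
Local Notation z := ('X_ord0 : S).
Local Notation A' := (A `\ H).
Local Notation A'' := (restriction A H).

Let HX : (H <= X)%VS := (cA HA).1.
Let dX : \dim X = (\dim H).+1 := (cA HA).2.

Let nXK K : K \in A -> ~~ (X <= K)%VS.
Proof. by move=> /cA[_ dK]; apply/negP => /dimvS; rewrite dK ltnn. Qed.

Let nHL L : L \in A'' -> ~~ (H <= L)%VS.
Proof. by move=> /cH[_ dK]; apply/negP => /dimvS; rewrite dK ltnn. Qed.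

Let dimA K : K \in A -> \dim K = \dim H.
Proof. by move=> /cA[_]; rewrite dX => -[]. Qed.

Let A'P K : K \in A' -> [/\ K \in A, K != H & (K :&: H)%VS \in A''].
Proof.
rewrite in_fsetD1 => /andP[KH KA]; split=> //.
apply/restrictionP; exists K; split=> //.
by apply: contra KH => HK; rewrite eq_sym eqEdim HK (dimA KA) /=.
Qed.

Lemma defining_formX0 : defining_form b H z.
Proof.
split=> [|x]; first by rewrite dhomogX /= mdeg1.
rewrite mevalXU big_ord_recl [tnth _ ord0](tnth_nth 0) /=.
have sH : \sum_(i < n) x (lift ord0 i) *: tnth b (lift ord0 i) \in H.
  apply: memv_suml => i _; rewrite memvZ // (basis_mem bH) //.
  by rewrite (tnth_nth 0) /= mem_nth // size_tuple; exact: ltn_ord.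
rewrite rpredDr //; split=> [->|xv]; first by rewrite scale0r mem0v.
apply/eqP; apply: contraT => x0; case/negP: (nXK HA).
rewrite -(span_basis bX) span_cons (span_basis bH) subv_add subvv andbT.
by rewrite -memvE -(scalerK x0 v) memvZ.
Qed.

(** A form of [K] without its [z]-term is, on [H], a form of the intersection, hence proportional to
    [f]; it remains to rescale. *)
Lemma defining_form_ext K f : K \in A' -> defining_form b' (K :&: H)%VS f ->
  exists t, defining_form b K (ext f + t *: z).
Proof.
move=> KA' fL; have [KA KH LA] := A'P KA'.
have [KX dK] := cA KA.
have [phi hphi] := hyperplane_functional KX dK.
have gK := defining_form_scalar bX hphi.
have gL : defining_form b' (K :&: H)%VS
    (\sum_(i < n) phi (tnth b' i) *: ('X_i : S0)).
  apply: (defining_form_scalar bH) => x xH.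
  by rewrite memv_cap xH andbT hphi // (subvP HX).
have [c c0 gE] := defining_form_uniq bH gL fL (nHL LA).
exists (c * phi v); have := defining_formZ c0 gK; congr defining_form.
rewrite big_ord_recl [tnth _ ord0](tnth_nth 0) /= scalerDr scalerA addrC.
congr (_ + _); rewrite gE comp_mpolyZ [ext _]linear_sum /=; congr (_ *: _).
apply: eq_bigr => i _; rewrite comp_mpolyZ extX; congr (phi _ *: _).
by rewrite !(tnth_nth 0).
Qed.

(** As [th] maps [z] into the ideal of [z], it induces a derivation of the quotient, the coordinate
    ring of [H]. A form of a restricted hyperplane differs from one of some [K] only by a multiple
    of [z]. *)
Lemma log_derivation_restr th : log_derivation b A' th -> mdvd z (th z) ->
  log_derivation b' A'' (fun f => rho (th (ext f))).
Proof.
move=> [dth lth] zth; split; first exact: derivation_section (@extK _ _) dth.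
move=> L f /restrictionP[K [KA HK ->]] fL.
have KA' : K \in A'.
  by rewrite in_fsetD1 KA andbT; apply: contraNneq HK => ->; exact: subvv.
have [t gK] := defining_form_ext KA' fL.
have [g /(congr1 (fun p => rho p))] := lth _ _ KA' gK.
rewrite (derivationD dth) (derivationZ dth) rmorphM !rmorphD /= !comp_mpolyZ.
rewrite restrX0 (restr_eq0 (th z)).1 // scaler0 !addr0 extK => ->.
by exists (rho g).
Qed.

Lemma prod_homog (I : eqType) (r : seq I) (F : I -> S0) (D : I -> nat) :
  {in r, forall i, F i \is (D i).-homog} ->
  \prod_(i <- r) F i \is (\sum_(i <- r) D i)%N.-homog.
Proof.
move=> h; rewrite big_seq [(\sum_(i <- r) _)%N]big_seq.
elim/big_ind2: _ => [|x d1 y d2|i /h //]; first exact: dhomog1.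
exact: dhomogM.
Qed.

(* For K over L, the form of K is [ext beta + t z] with [beta] a form of L, and
   [ext beta * th z - z * th (ext beta)] is divisible by each of these. *)
Lemma restr_divisor :
  exists B : S0, [/\ B != 0, B \is (#|` A' | - #|` A'' |)%N.-homog
    & forall th, log_derivation b A' th -> mdvd B (rho (th z))].
Proof.
have /boolp.choice[beta hbeta] : forall L, exists f : S0,
    L \in A'' -> defining_form b' L f.
  move=> L; have [LA|_] := boolP (L \in A''); last by exists 0.
  have [LH dL] := cH LA.
  by have [f] := defining_form_exists bH LH dL; exists f.
have /boolp.choice[t ht] : forall K, exists t : R, K \in A' ->
    defining_form b K (ext (beta (K :&: H)%VS) + t *: z).
  move=> K; have [KA|_] := boolP (K \in A'); last by exists 0.
  have [_ _ /hbeta/(defining_form_ext KA)[t]] := A'P KA.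
  by exists t.
pose over L := [seq K <- A' | (K :&: H)%VS == L].
have over_uniq L : uniq (over L) by exact: filter_uniq (fset_uniq _).
have overE L K : K \in over L = (K \in A') && ((K :&: H)%VS == L).
  by rewrite mem_filter andbC.
have beta0 L : L \in A'' -> beta L != 0.
  by move=> LA; apply: (defining_form_neq0 bH (hbeta L LA)); exact: nHL.
have size_over L : L \in A'' -> (0 < size (over L))%N.
  move=> /restrictionP[K [KA HK ->]]; rewrite -has_predT; apply/hasP.
  exists K => //; rewrite overE eqxx andbT in_fsetD1 KA andbT.
  by apply: contraNneq HK => ->; exact: subvv.
(* Each [L] contributes one factor less than there are hyperplanes over it. Every member of [A']
   lies over exactly one [L], so the degree is the difference of the cardinalities. *)
exists (\prod_(L <- A'') beta L ^+ (size (over L)).-1); split.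
- rewrite prodf_seq_neq0; apply/allP => L LA /=.
  by rewrite expf_neq0 // beta0.
- rewrite (_ : (_ - _)%N = (\sum_(L <- A'') (size (over L)).-1)%N); last first.
    have sumE : (\sum_(L <- A'') size (over L))%N = #|` A'|.
      under eq_bigr => L _ do rewrite size_filter -sum1_count.
      rewrite (exchange_big_dep predT) //= -sum1_size.
      rewrite big_seq [RHS]big_seq; apply: eq_bigr => K /A'P[_ _ LA].
      under eq_bigl => L do rewrite eq_sym.
      by rewrite sum1_count count_uniq_mem ?LA // fset_uniq.
    rewrite -sumE -[X in (_ - X)%N]sum1_size big_seq [X in (_ - X)%N]big_seq.
    rewrite [RHS]big_seq -sumnB => [|L LA]; last exact: size_over.
    by apply: eq_bigr => ? _; rewrite subn1.
  apply: prod_homog => L LA; rewrite -[X in X.-homog]mul1n.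
  by apply: dhomogMn; exact: (hbeta L LA).1.
move=> th [dth lth]; apply: mdvd_prod => [|L L' LA LA' LL'|L LA].
- exact: fset_uniq.
- apply: mcoprimeXr; apply: mcoprimeXl; first exact: beta0.
  have [LH dL] := cH LA; have [_ dL'] := cH LA'.
  apply: (defining_form_coprime bH LH _ _ _ (hbeta _ LA) (hbeta _ LA')) => //.
    exact: nHL.
  by apply/eqP; rewrite -eqSS -dL dL'.
pose om := ext (beta L) * th z - z * th (ext (beta L)).
have dv : mdvd (\prod_(K <- over L) (ext (beta L) + t K *: z)) om.
  apply: mdvd_prod => // [K K'|K]; rewrite !overE.
    move=> /andP[KA /eqP KL] /andP[KA' /eqP KL'] KK'.
    have [[KAA _ _] [KAA' _ _]] := (A'P KA, A'P KA').
    have := ht _ KA; rewrite KL => fK; have := ht _ KA'; rewrite KL' => fK'.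
    apply: (defining_form_coprime bX _ _ _ _ fK fK') => //.
    - exact: (cA KAA).1.
    - exact: nXK.
    - by rewrite !dimA.
  move=> /andP[KA /eqP KL].
  have := ht _ KA; rewrite KL => fK; have [g gE] := lth _ _ KA fK.
  have -> : om = (ext (beta L) + t K *: z) * th z -
      z * th (ext (beta L) + t K *: z).
    rewrite (derivationD dth) (derivationZ dth) mulrDl mulrDr opprD addrACA.
    by rewrite -scalerAl -scalerAr subrr addr0.
  apply: mdvdB; first by exists (th z).
  by apply: mdvdMl; exists g.
(* Restricted to [H], every factor becomes [beta L] and [om] becomes [beta L] times the restriction
   of [th z]; one [beta L] cancels. *)
have [g] := dv; move=> /(congr1 (fun p => rho p)).
rewrite rmorphB !rmorphM /= restrX0 mul0r subr0 extK rmorph_prod /=.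
under eq_bigr => K _ do
  rewrite comp_mpolyD comp_mpolyZ restrX0 scaler0 addr0 extK.
rewrite big_const_seq count_predT iter_mulr_1 -(prednK (size_over _ LA)).
rewrite exprS -mulrA => /(mulfI (beta0 _ LA)) ->.
by exists (rho g).
Qed.

(** Taking the component of degree [d - E j] of each coefficient keeps the identity on the
    variables, hence everywhere; basis elements of degree above [d] drop out. *)
Lemma homog_coordinates m k (bm : m.-tuple W) B
    (eta : 'I_k -> {mpoly R[m]} -> {mpoly R[m]}) (E : 'I_k -> nat) d psi :
  log_derivation_basis bm B eta ->
  (forall j, derivation_homog (E j) (eta j)) ->
  log_derivation bm B psi -> derivation_homog d psi ->
  exists2 c : 'I_k -> {mpoly R[m]},
    forall f, psi f = \sum_j c j * eta j f & forall j, (d < E j)%N -> c j = 0.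
Proof.
move=> [leta1 _ leta3] heta lpsi hpsi; have [c hc] := leta3 _ lpsi.
exists (fun j => if (E j <= d)%N then pihomog mdeg (d - E j) (c j) else 0).
  apply: derivation_ext lpsi.1 _ _ => [|i].
    by apply: derivation_lincomb => j; exact: (leta1 j).1.
  rewrite -(pihomog_dE (hpsi i)) hc linear_sum; apply: eq_bigr => j _ /=.
  rewrite [c j * _]mulrC (pihomogM _ _ (heta j i)).
  by case: ifP => _; rewrite ?mul0r // mulrC.
by move=> j dE; rewrite leqNgt dE.
Qed.

(** Otherwise the low basis elements restrict to dependent derivations. The relation lifts to a
    combination divisible by [z], whereas a basis of the logarithmic derivations of [A'] is
    independent modulo [z]. *)
Lemma exists_nonlog d (e' : seq nat)
    (th : 'I_n.+1 -> S -> S) (eta : 'I_n -> S0 -> S0) :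
  log_derivation_basis b A' th ->
  (forall i : 'I_n.+1, derivation_homog (nth 0%N (d :: e') i) (th i)) ->
  log_derivation_basis b' A'' eta ->
  (forall j : 'I_n, derivation_homog (nth 0%N e' j) (eta j)) ->
  exists2 i : 'I_n.+1, (nth 0%N (d :: e') i <= d)%N & rho (th i z) != 0.
Proof.
move=> [lth1 lth2 lth3] hth leta heta.
set D := fun i : 'I_n.+1 => nth 0%N (d :: e') i.
case: (pickP [pred i : 'I_n.+1 | (D i <= d)%N & rho (th i z) != 0]).
  by move=> i /andP[]; exists i.
move=> none; exfalso.
have zth i : (D i <= d)%N -> mdvd z (th i z).
  move=> iD; apply/restr_eq0; apply/eqP.
  by have := none i; rewrite /= iD => /negbFE.
have /fin_all_exists[c hc] : forall i, exists c : 'I_n -> S0, (D i <= d)%N ->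
    (forall f, rho (th i (ext f)) = \sum_j c j * eta j f) /\
    forall j : 'I_n, (D i < nth 0%N e' j)%N -> c j = 0.
  move=> i; case: (leqP (D i) d) => [iD|_]; last by exists (fun=> 0).
  have lR := log_derivation_restr (lth1 i) (zth i iD).
  have [|c c1 c2] := homog_coordinates leta heta lR (d := D i).
    by move=> j; rewrite extX; apply: restr_homog; exact: hth.
  by exists c.
(* Unit rows at the high indices replace a count of the low ones: a left kernel vector always
   exists, and it turns out to be supported on low indices. *)
pose M : 'M[S0]_(n.+1, n) := \matrix_(i, j)
  if (D i <= d)%N then c i j else (i == lift ord0 j)%:R.
have [u u0 uM] := idomain_kernel M.
(* In the column of a high index the low rows vanish, as the corresponding [eta j] has degree above
   [d]; only the unit entry is left. *)
have uD i : ~~ (D i <= d)%N -> u 0 i = 0.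
  case: (unliftP ord0 i) => [j ->|-> /negP[]]; last by rewrite /D.
  move=> jD; have := congr1 (fun v : 'rV_n => v 0 j) uM.
  rewrite !mxE (bigD1 (lift ord0 j)) //= mxE (negPf jD) eqxx mulr1.
  rewrite big1 ?addr0 // => i' ij; rewrite mxE.
  case: ifP => iD; last by rewrite (negPf ij) mulr0.
  have [_ ->] := hc i' iD; first by rewrite mulr0.
  by apply: leq_ltn_trans iD _; rewrite ltnNge.
have uth f : rho (\sum_i ext (u 0 i) * th i (ext f)) = 0.
  rewrite raddf_sum /=.
  under eq_bigr => i _ do rewrite rmorphM /= extK.
  transitivity (\sum_j (u *m M) 0 j * eta j f); last first.
    by rewrite uM big1 // => j _; rewrite mxE mul0r.
  under [RHS]eq_bigr => j _ do rewrite mxE mulr_suml.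
  rewrite exchange_big /=; apply: eq_bigr => i _.
  have [iD|/uD ->] := boolP (D i <= d)%N; last first.
    by rewrite mul0r big1 // => j _; rewrite !mul0r.
  rewrite (hc i iD).1 mulr_sumr; apply: eq_bigr => j _.
  by rewrite mxE iD mulrA.
have uthX (k : 'I_n.+1) : exists g, \sum_i ext (u 0 i) * th i 'X_k = z * g.
  apply/restr_eq0; case: (unliftP ord0 k) => [j ->|->].
    by rewrite -extX uth.
  rewrite raddf_sum big1 // => i _ /=; rewrite rmorphM /= extK.
  have [/zth/restr_eq0 ->|/uD ->] := boolP (D i <= d)%N; first by rewrite mulr0.
  by rewrite mul0r.
have {uthX}[g hg] := fin_all_exists uthX.
(* The combination divided by [z] is still logarithmic for [A'], because the forms of the other
   hyperplanes are coprime to [z]. Expanding it in the basis shows that [z] divides every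
   [ext (u 0 i)], which forces [u = 0]. *)
pose psi f := \sum_(k < n.+1) g k * f^`M(k).
have dpsi : is_derivation psi by exact: derivation_mderiv.
have psiE f : \sum_i ext (u 0 i) * th i f = z * psi f.
  rewrite mulr_sumr.
  under eq_bigr => i _ do rewrite (derivationE (lth1 i).1) mulr_sumr.
  rewrite exchange_big; apply: eq_bigr => k _ /=.
  rewrite mulrA -hg mulr_suml; apply: eq_bigr => i _.
  by rewrite mulrA.
have lpsi : log_derivation b A' psi.
  split=> // K f KA fK.
  have [KAA KH _] := A'P KA; have [KX dK] := cA KAA.
  apply: (defining_form_coprime bX KX (nXK KAA) _ KH fK defining_formX0).
    by rewrite dimA.
  rewrite -psiE; apply: mdvd_sum => i _; apply: mdvdMl.
  exact: (lth1 i).2 KA fK.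
have [q hq] := lth3 _ lpsi.
have /(_ _)/= uz := lth2 (fun i => ext (u 0 i) - z * q i).
case/eqP: u0; apply/rowP => i; rewrite mxE -[u 0 i]extK.
have /eqP : ext (u 0 i) - z * q i = 0.
  apply: uz => f; under eq_bigr => k _ do rewrite mulrBl -mulrA.
  by rewrite sumrB psiE hq mulr_sumr subrr.
by rewrite subr_eq0 => /eqP ->; rewrite rmorphM /= restrX0 mul0r.
Qed.

Lemma log_derivation_basis_add i (th : 'I_n.+1 -> S -> S) :
  log_derivation_basis b A' th -> (forall j, j != i -> rho (th j z) = 0) ->
  rho (th i z) != 0 ->
  log_derivation_basis b A (fun j f => if j == i then z * th i f else th j f).
Proof.
move=> [lth1 lth2 lth3] thj thi.
have A'A : A' `<=` A by exact: fsubD1set.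
have form0 f : defining_form b H f -> exists2 c, c != 0 & f = c *: z.
  by move=> fH; apply: (defining_form_uniq bX defining_formX0 fH); exact: nXK.
split=> [j|c hc j|psi [dpsi lpsi]].
- split=> [|K f KA fK].
    have [_|_] := eqVneq j i; last exact: (lth1 j).1.
    have [d1 d2] := (lth1 i).1; split=> [a f g|f g].
      by rewrite d1 mulrDr scalerAr.
    by rewrite d2 mulrDr !(mulrCA z).
  have [KH|KH] := eqVneq K H; last first.
    have KA' : K \in A' by rewrite in_fsetD1 KH.
    have [_|_] := eqVneq j i; last exact: (lth1 j).2 KA' fK.
    by apply: mdvdMl; exact: (lth1 i).2 KA' fK.
  rewrite KH in fK; have [c c0 fE] := form0 _ fK.
  have zE : z = c^-1 *: f by rewrite fE scalerA mulVf // scale1r.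
  have [_|ji] := eqVneq j i.
    by apply: mdvdMr; rewrite zE; apply: mdvdZ; exists 1; rewrite mulr1.
  have /restr_eq0[g gE] := thj j ji.
  rewrite {1}fE (derivationZ (lth1 j).1) gE; exists g.
  by rewrite fE scalerAl.
- have h : forall k, (if k == i then c k * z else c k) = 0.
    apply: lth2 => f; rewrite -[RHS](hc f); apply: eq_bigr => k _.
    by case: eqP => // ->; rewrite mulrA.
  have := h j; case: eqP => // _ /eqP.
  by rewrite mulf_eq0 (negPf (mpolyX_neq0 _ _)) orbF => /eqP.
have [|c hc] := lth3 psi.
  by split=> // K f KA; apply: lpsi; exact: (fsubsetP A'A).
(* Evaluating at [z] and restricting to [H] kills all terms but that of [i], whose factor
   [rho (th i z)] is nonzero; thus [z] divides [c i]. *)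
have : rho (c i) = 0.
  have /restr_eq0 : mdvd z (psi z) by exact: lpsi HA defining_formX0.
  rewrite hc raddf_sum (bigD1 i) //= big1 => [|j ji]; last first.
    by rewrite rmorphM /= thj // mulr0.
  rewrite addr0 rmorphM /= => /eqP.
  by rewrite mulf_eq0 (negPf thi) orbF => /eqP.
move=> /restr_eq0[q cq].
exists (fun j => if j == i then q else c j) => f; rewrite hc.
apply: eq_bigr => j _; case: eqP => // ->.
by rewrite cq mulrA [q * z]mulrC.
Qed.

Lemma free_addition_adapted d e' :
  free_with_exponents X A' (d :: e') -> free_with_exponents H A'' e' ->
  size e' = n -> #|` A'| = (d + sumn e')%N -> #|` A''| = sumn e' ->
  free_with_exponents X A (d.+1 :: e').
Proof.
move=> fA' fA'' se cA' cA''.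
have [th [lth hth]] := free_with_exponentsE fA' (congr1 succn se) bX.
have [eta [leta heta]] := free_with_exponentsE fA'' se bH.
have [i id thi] := exists_nonlog lth hth leta heta.
set D := fun i : 'I_n.+1 => nth 0%N (d :: e') i.
have [B [B0 Bd hB]] := restr_divisor.
rewrite cA' cA'' addnK in Bd.
have homB j h : rho (th j z) = B * h -> rho (th j z) =
    if (d <= D j)%N then B * pihomog mdeg (D j - d) h else 0.
  move=> thE; rewrite -(pihomogM _ _ Bd) -thE pihomog_dE //.
  exact: restr_homog (hth j ord0).
have [lth1 _ _] := lth; have [hi hiE] := hB _ (lth1 i).
have := homB i hi hiE.
(* A nonzero multiple of [B] has degree at least [d], so [D i = d] and the cofactor is a constant:
   [rho (th i z)] is a nonzero scalar times [B]. *)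
case: leqP => [dDi thE|_ thE]; last by rewrite thE eqxx in thi.
have Di : D i = d by apply/eqP; rewrite eqn_leq id dDi.
rewrite Di subnn in thE; have [c cE] := homog0C (pihomogP mdeg 0 hi).
rewrite cE mulrC mul_mpolyC in thE.
have c0 : c != 0 by apply: contraNneq thi => c0; rewrite thE c0 scale0r.
(* All the restrictions, being multiples of [B], are multiples of [rho (th i z)] by factors of
   degree [D j - d]; correcting by these preserves degrees. *)
have /fin_all_exists[u hu] : forall j, exists u : S0,
    [/\ rho (th j z) = u * rho (th i z),
        (d <= D j)%N -> u \is (D j - d).-homog & (D j < d)%N -> u = 0].
  move=> j; have [h /homB hE] := hB _ (lth1 j).
  have [dDj|Djd] := leqP d (D j); last first.
    by exists 0; split=> //; rewrite hE leqNgt Djd mul0r.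
  exists (c^-1 *: pihomog mdeg (D j - d) h); split=> // [|_].
    rewrite hE dDj thE -scalerAl -scalerAr scalerA mulVf // scale1r.
    by rewrite mulrC.
  by rewrite rpredZ // pihomogP.
pose U j : S := if j == i then 0 else ext (u j).
have Ui : U i = 0 by rewrite /U eqxx.
have := log_derivation_basis_transvect Ui lth.
set th' := fun j f => _; move=> lth'.
have thi' : rho (th' i z) != 0 by rewrite /th' Ui mul0r subr0.
have thj' j : j != i -> rho (th' j z) = 0.
  move=> ji; rewrite /th' /U (negPf ji) rmorphB rmorphM /= extK.
  by have [-> _ _] := hu j; rewrite subrr.
have lthA := log_derivation_basis_add lth' thj' thi'.
pose D2 j := if j == i then d.+1 else D j.
have hthA j : derivation_homog (D2 j)
    (fun f => if j == i then z * th' i f else th' j f).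
  move=> k; rewrite /D2 /th' Ui mul0r subr0; have [ji|ji] := eqVneq j i.
    apply: (@dhomogM _ _ mdeg 1 _ d); first by rewrite dhomogX /= mdeg1.
    by rewrite -Di; exact: hth.
  apply: rpredB; first exact: hth.
  rewrite /U (negPf ji); have [_ u1 u2] := hu j.
  have [/[dup] dDj /u1 uh|/u2 ->] := leqP d (D j); last first.
    by rewrite comp_mpoly0 mul0r dhomog0.
  rewrite -(subnK dDj); apply: dhomogM; first exact: ext_homog.
  by rewrite -Di; exact: hth.
(* The index [i] need not be the first: only its degree is known to be [d]. The exponents are
   therefore compared as multisets. *)
pose e2 := [seq D2 j | j <- enum 'I_n.+1].
have se2 : size e2 = n.+1 by rewrite size_map size_enum_ord.
apply: (free_with_exponents_perm (e := e2)); last first.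
  apply: (free_with_exponentsI cA bX se2 lthA) => j.
  by rewrite (nth_map j) ?size_enum_ord // nth_ord_enum; exact: hthA.
have permE := perm_to_rem (mem_enum 'I_n.+1 i).
have DE : [seq D j | j <- enum 'I_n.+1] = d :: e'.
  rewrite (map_comp (nth 0%N (d :: e')) val) val_enum_ord -se.
  exact: (mkseq_nth 0%N (d :: e')).
have remE : [seq D2 j | j <- rem i (enum 'I_n.+1)] =
    [seq D j | j <- rem i (enum 'I_n.+1)].
  apply/eq_in_map => j; rewrite mem_rem_uniq ?enum_uniq // inE => /andP[ji _].
  by rewrite /D2 (negPf ji).
have D2i : D2 i = d.+1 by rewrite /D2 eqxx.
have := perm_map D2 permE; rewrite /= remE D2i => /perm_trans; apply.
rewrite perm_cons -(perm_cons d) -DE perm_sym.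
by have := perm_map D permE; rewrite /= Di.
Qed.

End Addition.

Lemma free_addition (R : realType) (W : vectType R) (X H : {vspace W})
    (A : {fset {vspace W}}) d e' :
  central_arrangement X A -> H \in A ->
  free_with_exponents X (A `\ H) (d :: e') ->
  free_with_exponents H (restriction A H) e' ->
  size e' = \dim H -> #|` A `\ H| = (d + sumn e')%N ->
  #|` restriction A H| = sumn e' ->
  free_with_exponents X A (d.+1 :: e').
Proof.
move=> cA HA fA' fA'' se cA' cA''; have [HX dX] := cA _ HA.
have [v vX vH] : exists2 v, v \in X & v \notin H.
  by apply/subvPn; apply/negP => /dimvS; rewrite dX ltnn.
have bX : basis_of X [tuple of v :: vbasis H].
  rewrite basisEfree free_cons (span_basis (vbasisP H)) vH.
  rewrite (basis_free (vbasisP H)) /= size_tuple dX leqnn andbT.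
  by rewrite span_cons (span_basis (vbasisP H)) subv_add HX -memvE vX.
exact: (free_addition_adapted bX (vbasisP H) cA HA fA''.1 fA' fA'').
Qed.

(** * Deformations and their restrictions *)

Section InductiveFreeness.
Variables (R : realType) (W : vectType R).
Implicit Types (X H K : {vspace W}) (A : {fset {vspace W}}) (e : seq nat).

(** The two numerical clauses accompany freeness in the induction because the addition theorem
    compares degrees with numbers of hyperplanes. *)
Definition ind_free_with X A e : Prop :=
  [/\ inductively_free X A, free_with_exponents X A e, #|` A| = sumn e
    & size e = \dim X].

Lemma ind_free_with_perm X A e e' : perm_eq e e' ->
  ind_free_with X A e -> ind_free_with X A e'.
Proof.
move=> ee' [iA fA cA sA]; split=> //.
- exact: free_with_exponents_perm fA.
- by rewrite cA; exact: perm_sumn.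
- by rewrite -(perm_size ee').
Qed.

Lemma ind_free_with_empty X : ind_free_with X fset0 (nseq (\dim X) 0%N).
Proof.
split; first exact: InductivelyFree0.
- exact: free_with_exponents_empty.
- by rewrite cardfs0 sumn_nseq.
- by rewrite size_nseq.
Qed.

Lemma ind_free_with_add X H A d e : central_arrangement X A -> H \in A ->
  ind_free_with X (A `\ H) (d :: e) -> ind_free_with H (restriction A H) e ->
  ind_free_with X A (d.+1 :: e).
Proof.
move=> cA HA [iA' fA' cA' sA'] [iA'' fA'' cA'' sA'']; split.
- apply: InductivelyFreeAdd cA HA iA' iA'' fA' fA'' _ => i /=.
  exact: leq_addl.
- exact: free_addition cA HA fA' fA'' sA'' cA' cA''.
- by rewrite (cardfsD1 H) HA cA'.
- exact: sA'.
Qed.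

End InductiveFreeness.

Section Kernels.
Variables (R : realType) (W : vectType R).
Implicit Types (X : {vspace W}) (phi psi : 'Hom(W, R^o)).

Definition ker_in X phi : {vspace W} := (X :&: lker phi)%VS.

Lemma mem_ker_in X phi v : (v \in ker_in X phi) = (v \in X) && (phi v == 0).
Proof. by rewrite memv_cap memv_ker. Qed.

Lemma ker_in_sub X phi : (ker_in X phi <= X)%VS.
Proof. exact: capvSl. Qed.

Lemma eq_ker_in X phi psi :
  {in X, forall v, (phi v == 0) = (psi v == 0)} -> ker_in X phi = ker_in X psi.
Proof.
move=> h; apply/vspaceP => v; rewrite !mem_ker_in.
by case: (boolP (v \in X)) => //= /h ->.
Qed.

Lemma dim_ker_in X phi u : u \in X -> phi u != 0 ->
  \dim X = (\dim (ker_in X phi)).+1.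
Proof.
move=> uX pu; rewrite -(limg_ker_dim phi X) -addn1; congr (_ + _)%N.
apply/eqP; rewrite eqn_leq; apply/andP; split.
  by have := dimvS (subvf (phi @: X)%VS); rewrite dimvf.
rewrite lt0n dimv_eq0; apply: contraNneq pu => im0.
by rewrite -memv0 -im0 memv_img.
Qed.

Lemma ker_in_cap X phi psi :
  (ker_in X psi :&: ker_in X phi)%VS = ker_in (ker_in X phi) psi.
Proof.
apply/vspaceP => v; rewrite memv_cap !mem_ker_in.
by case: (v \in X); rewrite //= andbC.
Qed.

End Kernels.

(** * The family of deformations and its closure properties *)

Section Deformations.
Variables (R : realType) (W : vectType R) (l : nat).
Implicit Types (X K : {vspace W}) (A : {fset {vspace W}}) (J : {set 'I_l}).
Implicit Types (xi : 'I_l -> 'Hom(W, R^o)) (z : 'Hom(W, R^o)) (t : 'I_l -> nat).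
Implicit Types (a m M T : nat) (lo s : int) (i j k : 'I_l).

(** Linear independence on [X] of [z] and the [xi j], stated as the existence of points with
    prescribed values, from which separating points are built. *)
Definition coordinates X J xi z : Prop :=
  forall (c : 'I_l -> R) (w : R),
    exists u, [/\ u \in X, {in J, forall j, xi j u = c j} & z u = w].

Inductive deformed_hyperplane X a lo t J xi z : {vspace W} -> Prop :=
| HypInfinity : deformed_hyperplane X a lo t J xi z (ker_in X z)
| HypDiff i j s : i \in J -> j \in J -> i != j -> `|s| <= a%:Z ->
    deformed_hyperplane X a lo t J xi z
      (ker_in X (xi i - xi j - s%:~R *: z))
| HypCoord i s : i \in J -> lo <= s < lo + (t i)%:Z ->
    deformed_hyperplane X a lo t J xi z (ker_in X (xi i - s%:~R *: z)).

Definition deformed X a lo t J xi z A : Prop :=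
  forall K, K \in A <-> deformed_hyperplane X a lo t J xi z K.

Lemma diff_lfunE xi z i j s v :
  (xi i - xi j - s%:~R *: z) v = xi i v - xi j v - s%:~R * z v.
Proof. by rewrite !(add_lfunE, opp_lfunE, scale_lfunE). Qed.

Lemma coord_lfunE xi z i s v : (xi i - s%:~R *: z) v = xi i v - s%:~R * z v.
Proof. by rewrite !(add_lfunE, opp_lfunE, scale_lfunE). Qed.

(* A point where z = 0 and the coordinates are distinct and nonzero except for
   x_i = 0 lies on [x_i = s z] and on no hyperplane of another type. *)
Lemma coordinates_sep X J xi z i : coordinates X J xi z -> i \in J ->
  exists u, [/\ u \in X, xi i u = 0, z u = 0,
    {in J, forall j, j != i -> xi j u != 0}
    & {in J &, forall j k, j != k -> xi j u != xi k u}].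
Proof.
move=> co iJ.
have [u [uX uc uz]] := co (fun j => if j == i then 0 else j.+1%:R) 0.
exists u; split=> // [|j jJ ji|j k jJ kJ jk].
- by rewrite uc // eqxx.
- by rewrite uc // (negPf ji) pnatr_eq0.
rewrite !uc //; case: (eqVneq j i) => [ji|ji]; case: (eqVneq k i) => [ki|ki].
- by rewrite ji ki eqxx in jk.
- by rewrite eq_sym pnatr_eq0.
- by rewrite pnatr_eq0.
by rewrite eqr_nat eqSS.
Qed.

Lemma deformed_nontrivial X a lo t J xi z K : coordinates X J xi z ->
  deformed_hyperplane X a lo t J xi z K -> (K <= X)%VS /\ \dim X = (\dim K).+1.
Proof.
move=> co; case=> [|i j s iJ jJ ij _|i s iJ _]; split; try exact: ker_in_sub.
- have [u [uX _ uz]] := co (fun=> 0) 1; apply: (dim_ker_in uX).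
  by rewrite uz oner_eq0.
- have [u [uX _ uz _ uij]] := coordinates_sep co iJ; apply: (dim_ker_in uX).
  by rewrite diff_lfunE uz mulr0 subr0 subr_eq0 uij.
have [u [uX uc uz]] := co (fun=> 1) 0; apply: (dim_ker_in uX).
by rewrite coord_lfunE uz mulr0 subr0 uc // oner_eq0.
Qed.

Lemma deformed_central X a lo t J xi z A : coordinates X J xi z ->
  deformed X a lo t J xi z A -> central_arrangement X A.
Proof. by move=> co dA K /dA; exact: deformed_nontrivial co. Qed.

Lemma coordinates_ker X J xi z i s : coordinates X J xi z -> i \in J ->
  coordinates (ker_in X (xi i - s%:~R *: z)) (J :\ i) xi z.
Proof.
move=> co iJ c w.
have [u [uX uc uz]] := co (fun j => if j == i then s%:~R * w else c j) w.
exists u; split=> // [|j].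
  by rewrite mem_ker_in uX coord_lfunE uc // eqxx uz subrr eqxx.
by rewrite in_setD1 => /andP[ji jJ]; rewrite uc // (negPf ji).
Qed.

Lemma dim_coordinate_ker X J xi z i s : coordinates X J xi z -> i \in J ->
  \dim X = (\dim (ker_in X (xi i - s%:~R *: z))).+1.
Proof.
move=> co iJ; have [u [uX uc uz]] := co (fun=> 1) 0; apply: (dim_ker_in uX).
by rewrite coord_lfunE uz mulr0 subr0 uc // oner_eq0.
Qed.

(** By the condition on [lo'] and [t'], adjoining [s - a, ..., s + a] to each old interval gives an
    interval with the new lower end. Differences with [x_i] contribute these values; the hyperplanes
    parallel to [x_i = s] leave only [z = 0]. *)
Lemma deformed_restriction X a lo t J xi z A i s lo' t' :
  coordinates X J xi z -> deformed X a lo t J xi z A -> i \in J ->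
  (forall j s', j \in J -> j != i -> (lo' <= s' < lo' + (t' j)%:Z) =
    (lo <= s' < lo + (t j)%:Z) || (`|s' - s| <= a%:Z)) ->
  deformed (ker_in X (xi i - s%:~R *: z)) a lo' t' (J :\ i) xi z
    (restriction A (ker_in X (xi i - s%:~R *: z))).
Proof.
move=> co dA iJ hs; set Y := ker_in X _.
have coY : coordinates Y (J :\ i) xi z by exact: coordinates_ker.
have inY v : v \in Y -> xi i v = s%:~R * z v.
  by rewrite mem_ker_in coord_lfunE subr_eq0 => /andP[_ /eqP].
have memR phi : ker_in X phi \in A ->
    deformed_hyperplane Y a lo' t' (J :\ i) xi z (ker_in Y phi) ->
    ker_in Y phi \in restriction A Y.
  move=> phiA /(deformed_nontrivial coY)[_ dY].
  apply/restrictionP; exists (ker_in X phi); split=> //.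
    apply/negP => YK; have := dimvS (_ : (Y <= ker_in Y phi)%VS).
    rewrite dY ltnn. move=> h; apply: notF; apply: h. apply/subvP => v vY.
    have := subvP YK v vY; rewrite (mem_ker_in X phi) (mem_ker_in Y phi) vY.
    by move=> /andP[].
  by rewrite ker_in_cap.
move=> L; split=> [/restrictionP[K [/dA hK nYK ->]]|hL].
  case: hK nYK => [|j k s' jJ kJ jk hs'|j s' jJ hs'] nYK; rewrite ker_in_cap.
  - exact: HypInfinity.
  - case: (eqVneq j i) => [ji|ji]; last case: (eqVneq k i) => [ki|ki].
    + have -> : ker_in Y (xi j - xi k - s'%:~R *: z) =
          ker_in Y (xi k - (s - s')%:~R *: z).
        apply: eq_ker_in => v /inY vE; rewrite diff_lfunE coord_lfunE ji vE.
        by rewrite -oppr_eq0 rmorphB /=; congr (_ == 0); ring.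
      apply: HypCoord; first by rewrite in_setD1 kJ -ji eq_sym jk.
      by rewrite hs // -1?ji 1?eq_sym //; lia.
    + have -> : ker_in Y (xi j - xi k - s'%:~R *: z) =
          ker_in Y (xi j - (s + s')%:~R *: z).
        apply: eq_ker_in => v /inY vE; rewrite diff_lfunE coord_lfunE ki vE.
        by rewrite rmorphD /=; congr (_ == 0); ring.
      apply: HypCoord; first by rewrite in_setD1 jJ ji.
      by rewrite hs //; lia.
    by apply: HypDiff; rewrite ?in_setD1 ?ji ?ki.
  case: (eqVneq j i) => [ji|ji]; last first.
    by apply: HypCoord; rewrite ?in_setD1 ?ji // hs // hs'.
  have s's : s' != s.
    apply: contraNneq nYK => ->; rewrite ji; exact: subvv.
  have -> : ker_in Y (xi j - s'%:~R *: z) = ker_in Y z.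
    apply: eq_ker_in => v /inY vE; rewrite coord_lfunE ji vE -mulrBl -rmorphB.
    by rewrite mulf_eq0 intr_eq0 subr_eq0 eq_sym (negPf s's).
  exact: HypInfinity.
have := hL; case: hL => [|j k s'|j s'].
- by move=> h; apply: memR h; apply/dA; exact: HypInfinity.
- rewrite !in_setD1 => /andP[ji jJ] /andP[ki kJ] jk hs' h.
  by apply: memR h; apply/dA; exact: HypDiff.
rewrite in_setD1 => /andP[ji jJ]; rewrite hs // => /orP[hs'|hs'] h.
  by apply: memR h; apply/dA; exact: HypCoord.
have E : ker_in Y (xi j - s'%:~R *: z) =
    ker_in Y (xi j - xi i - (s' - s)%:~R *: z).
  apply: eq_ker_in => v /inY vE; rewrite diff_lfunE coord_lfunE vE.
  by rewrite rmorphB /=; congr (_ == 0); ring.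
rewrite E; apply: memR; last by rewrite -E.
by apply/dA; exact: HypDiff.
Qed.

Lemma deformed_delete X a lo t J xi z A i n :
  coordinates X J xi z -> deformed X a lo t J xi z A -> i \in J ->
  t i = n.+1 ->
  let K := ker_in X (xi i - (lo + n%:Z)%:~R *: z) in
  K \in A /\
  deformed X a lo (fun j => if j == i then n else t j) J xi z (A `\ K).
Proof.
move=> co dA iJ ti K; split.
  by apply/dA; apply: HypCoord => //; rewrite ti; lia.
(* A hyperplane that misses a point of [K] differs from [K]. The point used has [z = 0] against
   differences and other coordinates, and [z = 1] against infinity and the parallels of [K]. *)
have neq (phi : 'Hom(W, R^o)) u : u \in X -> phi u != 0 ->
    xi i u = (lo + n%:Z)%:~R * z u -> ker_in X phi != K.
  move=> uX pu iu; apply: contraNneq pu => pK.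
  have : u \in K by rewrite mem_ker_in uX coord_lfunE iu subrr eqxx.
  by rewrite -pK mem_ker_in => /andP[].
have [u [uX ui uz ujn ujk]] := coordinates_sep co iJ.
have uK : xi i u = (lo + n%:Z)%:~R * z u by rewrite ui uz mulr0.
move=> L; split=> [|hL].
  rewrite in_fsetD1 => /andP[LK /dA hL].
  case: hL LK => [|j k s jJ kJ jk hs|j s jJ hs] LK.
  - exact: HypInfinity.
  - exact: HypDiff.
  apply: HypCoord => //; case: eqP => // ji; rewrite ji ti in LK hs.
  suff : s != lo + n%:Z by lia.
  by apply: contraNneq LK => ->.
rewrite in_fsetD1; apply/andP; split; last first.
  apply/dA; case: hL => [|j k s jJ kJ jk hs|j s jJ hs].
  - exact: HypInfinity.
  - exact: HypDiff.
  apply: HypCoord => //; move: hs; case: eqP => // ->; rewrite ti; lia.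
case: hL => [|j k s jJ kJ jk hs|j s jJ].
- have [w [wX wc wz]] := co (fun=> (lo + n%:Z)%:~R) 1.
  by apply: (neq _ w) => //; rewrite ?wz ?oner_eq0 // wc // mulr1.
- by apply: (neq _ u) => //; rewrite diff_lfunE uz mulr0 subr0 subr_eq0 ujk.
case: eqP => [-> hs|/eqP ji hs]; last first.
  by apply: (neq _ u) => //; rewrite coord_lfunE uz mulr0 subr0 ujn.
have [w [wX wc wz]] := co (fun=> (lo + n%:Z)%:~R) 1.
apply: (neq _ w) => //; rewrite ?coord_lfunE ?wz ?mulr1 wc //.
rewrite -rmorphB intr_eq0; lia.
Qed.

Lemma coordinates_shift X J xi z i : coordinates X J xi z -> i \in J ->
  coordinates X (J :\ i) (fun j => xi j - xi i) z.
Proof.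
move=> co iJ c w.
have [u [uX uc uz]] := co (fun j => if j == i then 0 else c j) w.
exists u; split=> // j; rewrite in_setD1 => /andP[ji jJ].
by rewrite add_lfunE opp_lfunE !uc // eqxx (negPf ji) subr0.
Qed.

(** With all intervals empty only differences remain. Those to a fixed [x_i] serve as coordinates,
    each taking the values from [-a] to [a]. *)
Lemma deformed_shift X a lo t J xi z A i :
  deformed X a lo t J xi z A -> i \in J -> {in J, forall j, t j = 0%N} ->
  deformed X a (- a%:Z) (fun=> (2 * a).+1) (J :\ i) (fun j => xi j - xi i) z A.
Proof.
move=> dA iJ t0; set eta := (X in deformed _ _ _ _ _ X).
have etaE j : eta j = xi j - xi i by [].
clearbody eta; have etaB j k : eta j - eta k = xi j - xi k.
  by rewrite !etaE opprB addrA subrK.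
move=> K; rewrite dA; split.
  case=> [|j k s jJ kJ jk hs|j s jJ].
  - exact: HypInfinity.
  - case: (eqVneq j i) => [ji|ji]; last case: (eqVneq k i) => [ki|ki].
    + have -> : ker_in X (xi j - xi k - s%:~R *: z) =
          ker_in X (eta k - (- s)%:~R *: z).
        apply: eq_ker_in => v _.
        rewrite etaE !diff_lfunE ji -oppr_eq0 rmorphN /=.
        by congr (_ == 0); ring.
      apply: HypCoord; last by lia.
      by rewrite in_setD1 kJ -ji eq_sym jk.
    + rewrite ki -etaE; apply: HypCoord; last by lia.
      by rewrite in_setD1 jJ ji.
    by rewrite -etaB; apply: HypDiff; rewrite ?in_setD1 ?ji ?ki.
  by rewrite t0 //; lia.
case=> [|j k s|j s].
- exact: HypInfinity.
- rewrite !in_setD1 => /andP[ji jJ] /andP[ki kJ] jk hs.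
  by rewrite etaB; exact: HypDiff.
by rewrite in_setD1 => /andP[ji jJ] hs; rewrite etaE; apply: HypDiff => //; lia.
Qed.

End Deformations.

(** * Inductive freeness of the deformations *)

Section DeformedInductiveFreeness.
Variables (R : realType) (W : vectType R) (l : nat).
Implicit Types (X K : {vspace W}) (A : {fset {vspace W}}) (J : {set 'I_l}).
Implicit Types (xi : 'I_l -> 'Hom(W, R^o)) (z : 'Hom(W, R^o)) (t : 'I_l -> nat).
Implicit Types (a n m M T : nat) (lo s : int) (i j k : 'I_l).

(** [M] is the base length of the intervals, [S] their total length, and [m] counts the directions
    along which the arrangement is a product. The first entry is what the number of hyperplanes
    leaves for it: it grows with [S] while the others stay fixed, as in the addition theorem. *)
Definition deformed_exponents n a M S m : seq nat :=
  if n is n'.+1 then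
    [:: (S - n' * (M - a))%N, 1%N & iota (M + a * n').+1 n' ++ nseq m 0%N]
  else 1%N :: nseq m 0%N.

Lemma perm_swap (x y : nat) r : perm_eq [:: x, y & r] [:: y, x & r].
Proof. by apply/seq.permP => p /=; rewrite addnCA. Qed.

Lemma deformed_exponents_uniform n a T m : (a <= T)%N ->
  perm_eq (deformed_exponents n a T (n * T) m)
    (1%N :: iota (T + a * n.-1) n ++ nseq m 0%N).
Proof.
case: n => [|n] aT //=.
have -> : (n.+1 * T - n * (T - a) = T + a * n)%N by nia.
exact: perm_swap.
Qed.

Lemma deformed_ind_free0 X m a lo t xi z A :
  \dim X = m.+1 -> coordinates X set0 xi z -> deformed X a lo t set0 xi z A ->
  ind_free_with X A (1%N :: nseq m 0%N).
Proof.
move=> dX co dA; pose H := ker_in X z.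
have HA : H \in A by apply/dA; exact: HypInfinity.
have AH K : K \in A -> K = H.
  by move=> /dA[//|i j s|i s]; rewrite in_set0.
have cA := deformed_central co dA.
have A0 : A `\ H = fset0.
  apply/fsetP => K; rewrite in_fsetD1 in_fset0.
  by apply/negP => /andP[/eqP KH /AH].
have R0 : restriction A H = fset0.
  apply/fsetP => L; rewrite in_fset0; apply/negP => /restrictionP[K [/AH -> ]].
  by rewrite subvv.
apply: (ind_free_with_add cA HA).
  rewrite A0 -[_ :: _]/(nseq m.+1 0%N) -dX.
  exact: ind_free_with_empty.
have dH : \dim H = m by have [_] := cA _ HA; rewrite dX => -[].
by rewrite R0 -dH; exact: ind_free_with_empty.
Qed.

(** Induction on the number of coordinates and, inside, on [M] plus the total length. A hyperplane
    is removed from an interval of length [M + 1], or from any nonempty one if [M = a]. If all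
    lengths are [M > a], the same arrangement is read with base [M - 1]; if [M = a] and all
    intervals are empty, differences become the coordinates. *)
Lemma deformed_ind_free n X m a lo t J xi z A M :
  #|J| = n -> \dim X = (m + n).+1 -> coordinates X J xi z ->
  deformed X a lo t J xi z A -> (a <= M)%N ->
  {in J, forall i, (t i <= M.+1)%N} ->
  M = a \/ {in J, forall i, (M <= t i)%N} ->
  ind_free_with X A (deformed_exponents n a M (\sum_(i in J) t i) m).
Proof.
elim: n X m lo t J xi z A M
  => [|n IHn] X m lo t J xi z A M cJ dX co dA aM tM Mt.
  move/eqP: cJ; rewrite cards_eq0 => /eqP J0; rewrite J0 in co dA.
  by rewrite addn0 in dX; exact: deformed_ind_free0 dX co dA.
have uniform Y m' lo' J' xi' z' A' T : #|J'| = n -> \dim Y = (m' + n).+1 ->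
    coordinates Y J' xi' z' -> deformed Y a lo' (fun=> T) J' xi' z' A' ->
    (a <= T)%N ->
    ind_free_with Y A' (1%N :: iota (T + a * n.-1) n ++ nseq m' 0%N).
  move=> cJ' dY coY dA' aT.
  apply: (ind_free_with_perm (deformed_exponents_uniform n m' aT)).
  have := IHn Y m' lo' (fun=> T) J' xi' z' A' T cJ' dY coY dA' aT.
  rewrite sum_nat_const cJ'; apply; first by move=> i _; exact: leqnSn.
  by right => i _.
(* The run of exponents starts where that of a restriction with intervals of length [b + a + 1]
   does; for [n = 0] both runs are empty. *)
have iotaT b : (b + a * n).+1 = (b + a.+1 + a * n.-1)%N \/ n = 0%N.
  by case: (n) => [|n']; [right | left => /=; lia].
have cJ1 i : i \in J -> #|J :\ i| = n.
  by move=> iJ; move: cJ; rewrite (cardsD1 i) iJ => -[].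
have [N] := ubnP (M + \sum_(i in J) t i).
elim: N M t A aM tM Mt dA => // N IHN M t A aM tM Mt dA; rewrite ltnS => leN.
(* Every removal has a restriction with equal intervals of length [M + a + 1], whose exponents are
   all entries but the first. The last condition keeps the lengths admissible after the removal. *)
have remove i lo' : i \in J -> (0 < t i)%N -> ((t i).-1 <= M)%N ->
    (forall j s', j \in J -> j != i -> (lo' <= s' < lo' + (M + a.+1)%:Z) =
      (lo <= s' < lo + (t j)%:Z) || (`|s' - (lo + (t i).-1%:Z)| <= a%:Z)) ->
    (M = a \/ t i = M.+1) ->
    ind_free_with X A (deformed_exponents n.+1 a M (\sum_(i in J) t i) m).
  move=> iJ ti0 tiM hlo cM.
  have tiE : t i = (t i).-1.+1 by rewrite prednK.
  have [KA dA'] := deformed_delete co dA iJ tiE.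
  set K := ker_in X _ in KA dA'; set t' := (fun j => _) in dA'.
  have sumE : (\sum_(i in J) t i = (\sum_(i in J) t' i).+1)%N.
    rewrite (bigD1 i) //= [in RHS](bigD1 i) //= /t' eqxx tiE addSn.
    congr (_ + _).+1.
    by apply: eq_bigr => j /andP[_ /negPf ->].
  have t'M : {in J, forall j, (t' j <= M.+1)%N}.
    move=> j jJ; rewrite /t'; case: eqP => _; last exact: tM.
    exact: leq_trans (leqnSn _).
  have Mt' : M = a \/ {in J, forall j, (M <= t' j)%N}.
    case: cM => [|tiM1]; first by left.
    case: Mt => [|Mt]; first by left.
    right=> j jJ; rewrite /t'; case: eqP => _; last exact: Mt.
    by rewrite tiM1.
  rewrite sumE addnS in leN.
  have fA' := IHN M t' (A `\ K) aM t'M Mt' dA' leN; rewrite sumE.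
  have fA'' : ind_free_with K (restriction A K)
      (1%N :: iota (M + a * n).+1 n ++ nseq m 0%N).
    have -> : iota (M + a * n).+1 n = iota (M + a.+1 + a * n.-1) n.
      by case: (iotaT M) => [->|->].
    have dR := deformed_restriction (lo' := lo')
      (t' := fun=> (M + a.+1)%N) co dA iJ hlo.
    apply: (uniform _ _ _ _ _ _ _ _ (cJ1 i iJ) _ (coordinates_ker _ co iJ) dR).
      have := dim_coordinate_ker (lo + (t i).-1%:Z) co iJ.
      by rewrite dX addnS => -[].
    by lia.
  have sumM : (n * (M - a) <= \sum_(i in J) t' i)%N.
    case: Mt' => [->|Mt']; first by rewrite subnn muln0.
    apply: leq_trans (_ : \sum_(i in J) M <= _)%N; last exact: leq_sum.
    rewrite sum_nat_const cJ; nia.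
  rewrite /= subSn //.
  exact: ind_free_with_add (deformed_central co dA) KA fA' fA''.
have [aeM|aM'] := eqVneq a M.
  subst M.
  case: (pickP [pred i | (i \in J) && (0 < t i)%N]) => [i /andP[iJ ti0]|t0].
    have tia := tM i iJ.
    (* With [s = lo + t i - 1], the other intervals, of length at most [a + 1], lie within
       [s - a, ..., s + a]. *)
    apply: (remove i (lo + (t i).-1%:Z - a%:Z) iJ ti0) => //; [lia| |by left].
    by move=> j s' /tM jJ _; lia.
  have {}t0 : {in J, forall i, t i = 0%N}.
    by move=> i iJ; have := t0 i; rewrite /= iJ lt0n => /negbFE/eqP.
  have [i iJ] : exists i, i \in J by apply/card_gt0P; rewrite cJ.
  rewrite /= subnn muln0 subn0 big1 //.
  have aT : (a <= (2 * a).+1)%N by lia.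
  (* Moving all coordinates together is one more product direction; its exponent 0 is the first
     entry of the claimed list, the total length being 0. *)
  have dX' : \dim X = (m.+1 + n).+1 by rewrite dX addSn addnS.
  have := uniform _ _ _ _ _ _ _ _ (cJ1 i iJ) dX' (coordinates_shift co iJ)
    (deformed_shift dA iJ t0) aT.
  have -> : iota ((2 * a).+1 + a * n.-1) n = iota (a + a * n).+1 n.
    by case: (iotaT a) => [->|->] //; congr iota; lia.
  apply: ind_free_with_perm; apply/seq.permP => p /=.
  by rewrite !count_cat /=; lia.
have {}Mt : {in J, forall i, (M <= t i)%N}.
  by case: Mt => // ME; rewrite ME eqxx in aM'.
case: (pickP [pred i | (i \in J) && (t i == M.+1)]) => [i /andP[iJ /eqP ti]|t1].
  (* Here [s = lo + M], and [s - a, ..., s + a] prolongs each interval, of length [M] or [M + 1], up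
     to [lo + M + a]. *)
  apply: (remove i lo iJ); rewrite ?ti //=; last by right.
  move=> j s' jJ _; have := tM j jJ; have := Mt j jJ; lia.
have {t1}tE : {in J, forall i, t i = M}.
  move=> i iJ; have := t1 i; rewrite /= iJ => /negbT/eqP.
  by have := tM i iJ; have := Mt i iJ; lia.
have M0 : (a < M)%N by rewrite ltn_neqAle aM'.
have sumE : (\sum_(i in J) t i = n.+1 * M)%N.
  by rewrite (eq_bigr _ tE) sum_nat_const cJ.
(* With base [M - 1] the first entry comes just after the end of the run, with base [M] just before
   its start; the multisets agree. *)
have := IHN M.-1 t A; rewrite sumE in leN *.
have le1 : (a <= M.-1)%N by lia.
have le2 : {in J, forall i, (t i <= M.-1.+1)%N} by move=> i /tE ->; lia.
have le3 : M.-1 = a \/ {in J, forall i, (M.-1 <= t i)%N}.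
  by right => i /tE ->; exact: leq_pred.
have le4 : (M.-1 + n.+1 * M < N)%N by lia.
move=> /(_ le1 le2 le3 dA le4); apply: ind_free_with_perm => /=.
have -> : (n.+1 * M - n * (M - a) = M + a * n)%N by nia.
have -> : (n.+1 * M - n * (M.-1 - a) = M + a * n + n)%N by nia.
have -> : (M.-1 + a * n).+1 = (M + a * n)%N by lia.
have iotaE : iota (M + a * n) n.+1 =
    rcons (iota (M + a * n) n) (M + a * n + n)%N.
  by rewrite -addn1 iotaD cats1.
apply/seq.permP => p; have := congr1 (count p) iotaE.
rewrite -cats1 /= !count_cat /=; lia.
Qed.

End DeformedInductiveFreeness.

(** * Flags *)

Section Flags.
Variables (R : realType) (W : vectType R).
Implicit Types (X Y H K : {vspace W}) (A B : {fset {vspace W}}).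

Lemma memv_bigcap (r : seq {vspace W}) (v : W) :
  (v \in \bigcap_(H <- r) H)%VS = all (fun H => v \in H) r.
Proof.
elim: r => [|H r IH]; first by rewrite big_nil memvf.
by rewrite big_cons memv_cap IH.
Qed.

Lemma restriction_id X A : central_arrangement X A -> restriction A X = A.
Proof.
move=> cA; apply/fsetP => L; apply/restrictionP/idP => [[K [KA _ ->]]|LA].
  by rewrite (capv_idPl (cA _ KA).1).
exists L; split=> //; last by rewrite (capv_idPl (cA _ LA).1).
by apply/negP => /dimvS; rewrite (cA _ LA).2 ltnn.
Qed.

Lemma restriction_trans X Y A : (Y <= X)%VS ->
  restriction (restriction A X) Y = restriction A Y.
Proof.
move=> YX; apply/fsetP => L; apply/restrictionP/restrictionP.
  move=> [K [/restrictionP[K' [KA XK ->]] nYK ->]]; exists K'; split=> //.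
    by apply: contra nYK => YK'; rewrite subv_cap YK'.
  by rewrite -capvA (capv_idPr YX).
move=> [K [KA nYK ->]]; exists (K :&: X)%VS; split.
- apply/restrictionP; exists K; split=> //.
  by apply: contra nYK; exact: subv_trans.
- by rewrite subv_cap negb_and nYK.
by rewrite -capvA (capv_idPr YX).
Qed.

(** Intersecting with [X] makes the empty family give the ambient space, so that the definition
    applies to restrictions. *)
Definition lattice_in X A Y : Prop :=
  exists2 B : {fset {vspace W}}, B `<=` A & Y = (X :&: \bigcap_(H <- B) H)%VS.

Lemma lattice_in_id X A : lattice_in X A X.
Proof. by exists fset0; rewrite ?fsub0set // big_seq_fset0 capvf. Qed.

Lemma lattice_in_restriction X A H Y : H \in A -> (H <= X)%VS ->
  lattice_in H (restriction A H) Y -> lattice_in X A Y.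
Proof.
move=> HA HX [B /fsubsetP BA ->].
(* [B] is lifted to [H] together with all hyperplanes of [A] whose trace on [H] belongs to [B]. *)
exists [fset K in A | (K == H) || ((K :&: H)%VS \in B)].
  by apply/fsubsetP => K; rewrite !inE => /andP[].
apply/vspaceP => v; rewrite !memv_cap !memv_bigcap.
apply/andP/andP => [[vH /allP vB]|[vX /allP vB]]; split.
- exact: (subvP HX).
- apply/allP => K; rewrite !inE => /andP[_ /orP[/eqP -> //|/vB]].
  by rewrite memv_cap => /andP[].
- by apply: vB; rewrite !inE HA eqxx.
apply/allP => L LB; have /restrictionP[K [KA _ LE]] := BA _ LB.
rewrite LE memv_cap; apply/andP; split; apply: vB; rewrite !inE ?HA ?eqxx //.
by rewrite KA -LE LB orbT.
Qed.

End Flags.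

Lemma sort_rcons_max (e e' : seq nat) x : perm_eq e (rcons e' x) ->
  all (fun y => y <= x)%N e' -> sort leq e = rcons (sort leq e') x.
Proof.
move=> pe le; apply: (sorted_eq leq_trans anti_leq).
- exact: sort_sorted leq_total _.
- rewrite (sorted_pairwise leq_trans) pairwise_rcons all_sort le /=.
  by rewrite -(sorted_pairwise leq_trans); exact: sort_sorted leq_total _.
by rewrite perm_sort (perm_trans pe) // -!cats1 perm_cat2r perm_sym perm_sort.
Qed.

(** * Flags in the deformations *)

Section DeformedFlags.
Variables (R : realType) (W : vectType R) (l : nat).
Variables (xi : 'I_l -> 'Hom(W, R^o)) (z : 'Hom(W, R^o)) (a : nat).
Implicit Types (X K : {vspace W}) (A : {fset {vspace W}}) (J : {set 'I_l}).
Implicit Types (t : 'I_l -> nat) (n m M : nat) (lo : int).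

(** On [x_i = lo] the other intervals grow by [a] and the base becomes [M + a], so the run keeps its
    start. Taking [i] with a shortest interval makes the lost exponent the largest. *)
Lemma deformed_exponents_flag J n M t i : #|J| = n.+1 -> (a < M)%N ->
  {in J, forall j, (M <= t j <= M.+1)%N} -> i \in J ->
  (t i = M \/ {in J, forall j, t j = M.+1}) ->
  exists2 x, perm_eq (deformed_exponents n.+1 a M (\sum_(j in J) t j) 0)
    (rcons (deformed_exponents n a (M + a)
       (\sum_(j in J :\ i) (t j + a)) 0) x) &
    all (fun y => y <= x)%N (deformed_exponents n a (M + a)
       (\sum_(j in J :\ i) (t j + a)) 0).
Proof.
move=> cJ aM tM iJ ti.
have cJ1 : #|J :\ i| = n by move: cJ; rewrite (cardsD1 i) iJ => -[].
rewrite big_split /= sum_nat_const cJ1 (big_setD1 i) //=.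
set S := (\sum_(j in J :\ i) t j)%N.
have SM : (n * M <= S <= n * M.+1)%N.
  rewrite -{1 2}cJ1 -!sum_nat_const; apply/andP; split; apply: leq_sum => j.
    by rewrite in_setD1 => /andP[_ /tM/andP[]].
  by rewrite in_setD1 => /andP[_ /tM/andP[]].
have S1 : t i = M \/ t i = M.+1 /\ S = (n * M.+1)%N.
  case: ti => [|tE]; [by left | right; split; first exact: tE].
  rewrite -cJ1 -sum_nat_const; apply: eq_bigr => j.
  by rewrite in_setD1 => /andP[_ /tE].
clearbody S; have [/andP[SM1 SM2]] := SM.
have tM' : (M <= t i <= M.+1)%N := tM i iJ.
case: n cJ cJ1 SM SM1 SM2 S1 => [|n] cJ cJ1 SM SM1 SM2 S1.
  exists (t i + S)%N; rewrite /= ?mul0n ?subn0; first exact: perm_swap.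
  by lia.
rewrite /= !cats0; set g := (M + a * n.+1)%N.
have -> : (M + a + a * n).+1 = g.+1 by rewrite /g; lia.
rewrite addnK.
have iotaE : g.+1 :: iota g.+2 n = rcons (iota g.+1 n) (g.+1 + n)%N.
  by rewrite -[LHS]/(iota g.+1 n.+1) -(addn1 n) iotaD cats1.
have all_iota x : (g + n <= x)%N -> all (fun y => y <= x)%N (iota g.+1 n).
  by move=> gx; apply/allP => y; rewrite mem_iota => /andP[_ yn]; lia.
(* If [t i = M], the first entry is unchanged and the end of the run is dropped. If all lengths are
   [M + 1], the first entry exceeds the run and is dropped, and the end of the run becomes the new
   first entry. *)
case: S1 => [tiE|[tiE SE]].
  exists (g.+1 + n)%N; last by rewrite /= all_iota /g; nia.
  by rewrite iotaE tiE (_ : (_ - _ = S + n.+1 * a - n * M)%N); last by nia.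
have -> : (t i + S - n.+1 * (M - a) = g.+1 + n.+1)%N by rewrite tiE SE /g; nia.
have -> : (S + n.+1 * a - n * M = g.+1 + n)%N by rewrite SE /g; nia.
exists (g.+1 + n.+1)%N; last by rewrite /= all_iota; lia.
rewrite iotaE; apply/seq.permP => p; rewrite -!cats1 /= !count_cat /=; lia.
Qed.

Lemma size_deformed_exponents n M m' m :
  size (deformed_exponents n a M m' m) = (m + n).+1.
Proof. by case: n => [|n] /=; rewrite ?size_cat ?size_iota size_nseq; lia. Qed.

Lemma deformed_flag_top n X lo J t A M :
  #|J| = n -> \dim X = n.+1 -> coordinates X J xi z ->
  deformed X a lo t J xi z A -> (a < M)%N ->
  {in J, forall j, (M <= t j <= M.+1)%N} ->
  let e := sort leq (deformed_exponents n a M (\sum_(i in J) t i) 0) in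
  [/\ lattice_in X A X, \dim X = n.+1
    & ind_free_with X (restriction A X) (take n.+1 e)].
Proof.
move=> cJ dX co dA aM tM e; split=> //; first exact: lattice_in_id.
rewrite (restriction_id (deformed_central co dA)).
rewrite take_oversize; last by rewrite size_sort size_deformed_exponents.
have := deformed_ind_free (m := 0) cJ dX co dA (ltnW aM).
move=> /(_ (fun j jJ => (andP (tM j jJ)).2)).
move=> /(_ (or_intror (fun j jJ => (andP (tM j jJ)).1))).
by apply: ind_free_with_perm; rewrite perm_sym perm_sort.
Qed.

Lemma deformed_flag n X lo J t A M :
  #|J| = n -> \dim X = n.+1 -> coordinates X J xi z ->
  deformed X a lo t J xi z A -> (a < M)%N ->
  {in J, forall j, (M <= t j <= M.+1)%N} ->
  let e := sort leq (deformed_exponents n a M (\sum_(i in J) t i) 0) in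
  exists F : nat -> {vspace W}, [/\ F n.+1 = X,
    forall d, (0 < d < n.+1)%N -> (F d <= F d.+1)%VS
    & forall d, (0 < d <= n.+1)%N -> [/\ lattice_in X A (F d), \dim (F d) = d
      & ind_free_with (F d) (restriction A (F d)) (take d e)]].
Proof.
elim: n X lo J t A M => [|n IHn] X lo J t A M cJ dX co dA aM tM e.
  exists (fun=> X); split=> // -[|[|d]] // _.
  exact: deformed_flag_top cJ dX co dA aM tM.
have cA := deformed_central co dA.
have [i iJ ti] : exists2 i, i \in J & t i = M \/ {in J, forall j, t j = M.+1}.
  case: (pickP [pred i | (i \in J) && (t i == M)]) => [i /andP[iJ /eqP]|tn].
    by exists i => //; left.
  have [i iJ] : exists i, i \in J by apply/card_gt0P; rewrite cJ.
  exists i => //; right=> j jJ; have := tn j; rewrite /= jJ => /negbT.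
  by have := tM j jJ; lia.
have [tiM tiM1] := andP (tM i iJ).
set Y := ker_in X (xi i - lo%:~R *: z).
have YA : Y \in A by apply/dA; apply: HypCoord => //; lia.
have [YX dY] := cA _ YA; rewrite dX in dY; case: dY => dY.
have cJ1 : #|J :\ i| = n by move: cJ; rewrite (cardsD1 i) iJ => -[].
(* Since [t j > a], adjoining [lo - a, ..., lo + a] only prolongs each interval downwards by [a]. *)
have dR : deformed Y a (lo - a%:Z) (fun j => t j + a)%N (J :\ i) xi z
    (restriction A Y).
  apply: (deformed_restriction co dA iJ) => j s' jJ _.
  by have := tM j jJ; lia.
have tM' : {in J :\ i, forall j, (M + a <= t j + a <= (M + a).+1)%N}.
  by move=> j; rewrite in_setD1 => /andP[_ /tM]; lia.
have aM' : (a < M + a)%N by lia.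
have [F [FY Fsub Fd]] := IHn Y _ _ _ _ _ cJ1 (esym dY)
  (coordinates_ker _ co iJ) dR aM' tM'.
have [x /sort_rcons_max h /h eE] := deformed_exponents_flag cJ aM tM iJ ti.
have FY' d : (0 < d <= n.+1)%N -> (F d <= Y)%VS.
  by move=> /Fd[[B _ ->] _ _]; exact: capvSl.
exists (fun d => if d == n.+2 then X else F d); split=> [|d dn|d dn].
- by rewrite eqxx.
- rewrite ifN; last by lia.
  have [dE|dE] := eqVneq d.+1 n.+2; last by apply: Fsub; lia.
  by apply: subv_trans YX; apply: FY'; lia.
have [->|dE] := eqVneq d n.+2; first exact: deformed_flag_top cJ dX co dA aM tM.
have dn' : (0 < d <= n.+1)%N by lia.
have [Lat dF fF] := Fd d dn'; split=> //.
  exact: lattice_in_restriction Lat.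
have -> : restriction A (F d) = restriction (restriction A Y) (F d).
  by rewrite restriction_trans // FY'.
(* The sorted exponents of the restriction are those of [A] without the last, so their initial
   segments of length [d <= n.+1] agree. *)
rewrite /e eE -cats1 takel_cat // size_sort.
by rewrite size_deformed_exponents; case/andP: dn'.
Qed.

End DeformedFlags.

(** * The cone *)

Section Cone.
Variable R : realType.

Definition entry N (j : 'I_N) (v : 'rV[R]_N) : R^o := v 0 j.

Lemma entry_is_linear N (j : 'I_N) : linear (entry j).
Proof. by move=> c u v; rewrite /entry !mxE. Qed.

HB.instance Definition _ N (j : 'I_N) :=
  GRing.isLinear.Build R 'rV[R]_N R^o *:%R (entry j) (entry_is_linear j).

Variables (l p n a m : nat).

Definition cone_coord (i : 'I_l) : 'Hom('rV[R]_(l + 1), R^o) :=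
  linfun (entry (lshift 1 i)).
Definition cone_infinity : 'Hom('rV[R]_(l + 1), R^o) :=
  linfun (entry (rshift l ord0)).
(** The number of integers from [- n * a] to [m], or to [m + 1]. *)
Definition cone_height (i : 'I_l) : nat :=
  (n * a + (if (i < p)%N then m else m.+1)).+1.

Lemma cone_coordinates J : coordinates fullv J cone_coord cone_infinity.
Proof.
move=> c w; exists (row_mx (\row_i c i) w%:M); split=> [|j _|].
- exact: memvf.
- by rewrite lfunE /= /entry row_mxEl mxE.
by rewrite lfunE /= /entry row_mxEr mxE.
Qed.

Lemma hyperplane_infinity :
  hyperplane (col_mx 0 1%:M) = ker_in fullv cone_infinity.
Proof.
apply/vspaceP => v; rewrite mem_ker_in memvf /= lfunE /= /entry.
rewrite -[v]hsubmxK [rsubmx v]mx11_scalar mem_cone_infinity.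
by rewrite row_mxEr !mxE.
Qed.

Lemma hyperplane_affine (c : 'cV[R]_l) (d : R)
    (phi : 'Hom('rV[R]_(l + 1), R^o)) :
  (forall v : 'rV[R]_(l + 1), phi v =
     \sum_(i < l) c i 0 * v 0 (lshift 1 i) - d * v 0 (rshift l 0)) ->
  hyperplane (col_mx c (- d%:M)) = ker_in fullv phi.
Proof.
move=> hphi; apply/vspaceP => v; rewrite mem_ker_in memvf /= hphi subr_eq0.
rewrite -{1}[v]hsubmxK [rsubmx v]mx11_scalar mem_cone_hyperplane !mxE.
by under eq_bigr => i _ do rewrite mxE.
Qed.

Lemma sum_delta (i : 'I_l) (x : 'I_l -> R) :
  \sum_(k < l) (delta_mx i 0 : 'cV[R]_l) k 0 * x k = x i.
Proof.
rewrite (bigD1 i) //= mxE !eqxx mul1r big1 ?addr0 // => k /negPf ki.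
by rewrite mxE ki mul0r.
Qed.

Lemma hyperplane_coord (i : 'I_l) (s : int) :
  hyperplane (col_mx (delta_mx i 0) (- (s%:~R)%:M)) =
  ker_in fullv (cone_coord i - s%:~R *: cone_infinity).
Proof.
apply: hyperplane_affine => v.
by rewrite sum_delta coord_lfunE !lfunE.
Qed.

Lemma hyperplane_diff (i j : 'I_l) (s : int) :
  hyperplane (col_mx (delta_mx i 0 - delta_mx j 0) (- (s%:~R)%:M)) =
  ker_in fullv (cone_coord i - cone_coord j - s%:~R *: cone_infinity).
Proof.
apply: hyperplane_affine => v.
under eq_bigr => k _ do rewrite mxE [X in _ + X]mxE mulrBl.
by rewrite sumrB !sum_delta diff_lfunE !lfunE.
Qed.

Lemma cone_deformed :
  deformed fullv a (- (n * a)%:Z) cone_height [set: 'I_l] cone_coord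
    cone_infinity (cone (arrE R l p n a m)).
Proof.
move=> K; rewrite in_fset1U; split.
  case/orP => [/eqP ->|/imfsetP[q /= qE ->]].
    by rewrite hyperplane_infinity; exact: HypInfinity.
  move: qE; rewrite mem_cat => /orP[] /allpairsPdep[].
    move=> [i j] [s [/= ]]; rewrite mem_filter /= => /andP[ij _].
    rewrite mem_int_range => hs ->; rewrite hyperplane_diff.
    apply: HypDiff; rewrite ?in_setT //; last by lia.
    by apply: contraTneq ij => ->; rewrite ltnn.
  move=> i [s [_]]; rewrite mem_int_range => hs -> /=; rewrite hyperplane_coord.
  by apply: HypCoord; rewrite ?in_setT // /cone_height; lia.
have memE q : q \in arrE R l p n a m -> hyperplane (col_mx q.1 (- q.2%:M)) \in
    [fset hyperplane (col_mx q.1 (- q.2%:M)) | q in arrE R l p n a m].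
  by move=> qE; apply/imfsetP; exists q.
have memD (i j : 'I_l) s : (i < j)%N -> `|s| <= a%:Z ->
    (delta_mx i 0 - delta_mx j 0, s%:~R) \in arrE R l p n a m.
  move=> ij hs; rewrite mem_cat; apply/orP; left.
  apply/allpairsPdep; exists (i, j), s; split=> //.
    by rewrite mem_filter /= ij mem_enum.
  by rewrite mem_int_range; lia.
case=> [|i j s _ _ ij hs|i s _ hs]; apply/orP.
- by left; rewrite hyperplane_infinity.
- right; case: (ltngtP i j) => [ltij|ltji|/val_inj ijE].
  + by rewrite -hyperplane_diff; apply: (memE (_, _)); exact: memD.
  2: by rewrite ijE eqxx in ij.
  (* For [i > j] the pair is reversed and [s] negated, which stays in the symmetric range. *)
  have -> : ker_in fullv
      (cone_coord i - cone_coord j - s%:~R *: cone_infinity) =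
      ker_in fullv (cone_coord j - cone_coord i - (- s)%:~R *: cone_infinity).
    apply: eq_ker_in => v _; rewrite !diff_lfunE -oppr_eq0 rmorphN /=.
    by congr (_ == 0); ring.
  rewrite -hyperplane_diff; apply: (memE (_, _)); apply: memD => //.
  by rewrite normrN.
right; rewrite -hyperplane_coord; apply: (memE (_, _)).
rewrite mem_cat; apply/orP; right.
apply/allpairsPdep; exists i, s; split=> //; first by rewrite mem_enum.
by rewrite mem_int_range; move: hs; rewrite /cone_height; lia.
Qed.

Lemma sum_cone_height : (p <= l)%N ->
  (\sum_(i in [set: 'I_l]) cone_height i = l * (n * a + m).+1 + (l - p))%N.
Proof.
move=> pl; rewrite (eq_bigl predT) => [|i]; last by rewrite in_setT.
have hE (i : 'I_l) : true -> cone_height i = ((n * a + m).+1 + (p <= i))%N.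
  by rewrite /cone_height; case: ltnP; lia.
rewrite (eq_bigr _ hE) big_split /= sum_nat_const card_ord; congr (_ + _)%N.
have := big_mkord predT (fun i => (p <= i) : nat).
move=> <-; rewrite (big_cat_nat _ pl) //=.
rewrite big_nat big1 ?add0n => [|i /andP[_ ip]]; last by rewrite leqNgt ip.
rewrite big_nat (eq_bigr (fun=> 1%N)) => [|i /andP[-> //]].
by rewrite -big_nat sum_nat_const_nat muln1.
Qed.

(** With base [M = n * a + m + 1] one has [M + a * (l - 1) = c + 1], so the run starts at [c + 2];
    the [l - p] longer intervals raise the first entry from [c + 1] to [c + 1 + l - p]. *)
Lemma cone_exponents_perm c : (0 < n)%N -> (0 < l)%N -> (p <= l)%N ->
  c = (m + a * (l + n - 1))%N ->
  perm_eq (deformed_exponents l a (n * a + m).+1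
             (\sum_(i in [set: 'I_l]) cone_height i) 0)
    [:: 1%N, (c + l - p + 1)%N & [seq (c + k)%N | k <- iota 2 (l - 1)]].
Proof.
move=> n0 l0 pl; rewrite sum_cone_height //.
case: l l0 pl => // l' _ pl cE; rewrite /deformed_exponents cats0 subn1 /=.
have -> : (l'.+1 * (n * a + m).+1 + (l'.+1 - p) - l' * ((n * a + m).+1 - a) =
    c + l'.+1 - p + 1)%N by rewrite cE; nia.
have -> : ((n * a + m).+1 + a * l').+1 = (c + 2)%N by rewrite cE; nia.
by rewrite iotaDl; exact: perm_swap.
Qed.

Lemma cone_ind_flag_accurate : (0 < n)%N -> (0 < l)%N -> (p <= l)%N ->
  let c := (m + a * (l + n - 1))%N in
  ind_flag_accurate (cone (arrE R l p n a m))
    [:: 1%N, (c + l - p + 1)%N & [seq (c + k)%N | k <- iota 2 (l - 1)]].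
Proof.
move=> n0 l0 pl c.
have /(perm_sortP leq_total leq_trans anti_leq) sortE :=
  cone_exponents_perm n0 l0 pl (erefl c).
have dW : \dim {: 'rV[R]_(l + 1)} = l.+1 by rewrite dimvf /dim /= mul1n addn1.
(* Here [n >= 1] enters: the flag requires every interval to have more than [a] values. *)
have aM : (a < (n * a + m).+1)%N by nia.
have tM : {in [set: 'I_l], forall j,
    ((n * a + m).+1 <= cone_height j <= (n * a + m).+2)%N}.
  by move=> j _; rewrite /cone_height; case: ifP; lia.
have cJ : #|[set: 'I_l]| = l by rewrite cardsT card_ord.
have co := cone_coordinates [set: 'I_l].
have [F [FX Fsub Fd]] := deformed_flag cJ dW co cone_deformed aM tM.
have [_ _ [iA fA _ _]] := deformed_flag_top cJ dW co cone_deformed aM tM.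
rewrite restriction_id in iA fA; last exact: deformed_central co cone_deformed.
rewrite take_oversize ?size_sort ?size_deformed_exponents // in fA.
split; rewrite -?sortE //.
exists F; rewrite dW; split=> // d /Fd[[B BA FB] dF [iF fF _ _]].
split=> //.
by exists B => //; rewrite FB capfv.
Qed.

End Cone.

Local Close Scope ring_scope.
Local Close Scope fset_scope.

Theorem theorem7p27 (R : realType) :
  (forall a m n l p : nat, (0 < n)%N -> (0 < l)%N -> (p <= l)%N ->
     let c := (m + a * (l + n - 1))%N in
     ind_flag_accurate (cone (arrE R l p n a m))
       [:: 1%N, (c + l - p + 1)%N & [seq (c + k)%N | k <- iota 2 (l - 1)]]) /\
  (forall c' m l p : nat, (0 < c')%N -> (0 < l)%N -> (p <= l)%N ->
     let c'' := (m + l + c' - 1)%N in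
     ind_flag_accurate (cone (arrE R l p c' 1 m))
       [:: 1%N, (c'' + l - p + 1)%N & [seq (c'' + k)%N | k <- iota 2 (l - 1)]]).
Proof.
split=> [a m n l p n0 l0 pl|c' m l p c0 l0 pl c''].
  exact: cone_ind_flag_accurate.
have -> : c'' = (m + 1 * (l + c' - 1))%N by rewrite /c'' mul1n; lia.
exact: cone_ind_flag_accurate.
Qed.
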